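(* Let $K$ be a field of characteristic $p>0$, $n\ge1$, and $\underline f=(f_1,\dots,f_n)\in K^n$ with $\Delta_n(\underline f)\neq0$. Let $A:=K[W_k,1\le k\le n]/(W_k^p-W_k-f_k)_{1\le k\le n}$, $w_i$ the image of $W_i$ in $A$, and $w\in A$, $Q\in K[W]$ as in the context, so that $A=K[w]\simeq K[W]/(Q(W))$ (with $w$ corresponding to the class of $W$). Let $\mathcal F:=\bigoplus_{i=1}^n\mathbb{F}_pf_i$ and $Z:=\bigoplus_{i=1}^n\mathbb{F}_p\Delta_{n-1}(\underline{\hat f_i})$, two $\mathbb{F}_p$-subspaces of $K$. (1) For $z\in Z$ let $\sigma_z$ be the $K$-algebra automorphism of $K[W]$ with $\sigma_z(W)=W+z$. Then $\sigma_z$ induces a $K$-algebra automorphism of $A$, still denoted $\sigma_z$. The map $z\in Z\mapsto\sigma_z\in\operatorname{Aut}_KA$ is an injective group homomorphism, and its image is a subgroup $G$ of $\operatorname{Aut}_KA$ isomorphic to $(\mathbb{Z}/p\mathbb{Z})^n$. (2) Let $U:=(Z/\Delta_n(\underline f))^p=\{(z/\Delta_n(\underline f))^p: z\in Z\}\subset K$, the $\mathbb{F}_p$-space of roots of the reversed polynomial of $P_{\mathcal F}(X):=\prod_{x\in\mathcal F}(X-x)$. Let $z\in Z$ and write $z=\Delta_n(\underline f)u^{1/p}$ with $u\in U$. For $\underline\epsilon=(\epsilon_1,\dots,\epsilon_n)\in\mathbb{F}_p^n\setminus\{(0,\dots,0)\}$ let $w_{\underline\epsilon}:=\sum_{i}\epsilon_iw_i\in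 A$ and $f_{\underline\epsilon}:=\sum_i\epsilon_if_i\in K$. Then $w_{\underline\epsilon}^p-w_{\underline\epsilon}=f_{\underline\epsilon}$, and $K[w_{\underline\epsilon}]\subset A$ is isomorphic to the $K$-algebra $K[W_{\underline\epsilon}]/(W_{\underline\epsilon}^p-W_{\underline\epsilon}-f_{\underline\epsilon})$, hence is a $K$-subalgebra of dimension $p$. Moreover $$\sigma_z(w_{\underline\epsilon})=w_{\underline\epsilon}+(-1)^{n-1}E(f_{\underline\epsilon},u),$$ where $E:\mathcal F\times U\to\mathbb{F}_p$ is the Elkies pairing. (3) Let $r$ be the dimension of the $\mathbb{F}_p$-vector space $\big((\sum_i\mathbb{F}_pf_i)+\{x^p-x:x\in K\}\big)/\{x^p-x:x\in K\}$. When $r=n$, i.e. when $A$ is a field and $G$ is the full group $\operatorname{Aut}_KA$, the set $\{K[w_{\underline\epsilon}] : \underline\epsilon\in\mathcal{E}\}$, where $\mathcal{E}$ is a set of representatives of $\mathbb{P}^{n-1}(\mathbb{F}_p)$, is equal to the set of the $\frac{p^n-1}{p-1}$ $p$-cyclic extensions of $K$ inside $A$.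
   Context: Here $q=p$. For $\underline a=(a_1,\dots,a_n)$ in a commutative ring containing $\mathbb{F}_p$, $\Delta_n(\underline a):=\det\big(a_j^{p^{i-1}}\big)_{1\le i,j\le n}$ is the Moore determinant, with $\Delta_0:=1$. $\underline{\hat f_i}:=(f_1,\dots,f_{i-1},f_{i+1},\dots,f_n)$. The element $w\in A$ is the determinant of the $n\times n$ matrix whose first row is $(w_1,\dots,w_n)$ and whose following rows are $(f_1^{p^k},\dots,f_n^{p^k})$ for $0\le k\le n-2$; equivalently $w=\sum_{i=1}^n(-1)^{i-1}\Delta_{n-1}(\underline{\hat f_i})\,w_i$. The polynomial $Q$ is $$Q(W)=\frac{\Delta_{n+1}(\Delta_{n-1}(\underline{\hat f_1}),\dots,\Delta_{n-1}(\underline{\hat f_n}),W)}{\Delta_n(\Delta_{n-1}(\underline{\hat f_1}),\dots,\Delta_{n-1}(\underline{\hat f_n}))}-\Delta_n(\underline f)^{p^{n-1}},$$ and it is known that $A=K[w]$ with $A\simeq K[W]/(Q(W))$. Write $P_{\mathcal F}(X)=\sum_{m=0}^nc_mX^{p^m}$ with $c_n=1$; its reversed polynomial is $\sum_{m=0}^nc_{n-m}^{p^m}X^{p^m}$, whose set of roots is $U$ (known). The Elkies pairing is $$E(x,u):=\sum_{m=1}^n\sum_{j=0}^{m-1}\big((c_mu)^{p^{-m}}x\big)^{p^j}\in\mathbb{F}_p\qquad(x\in\mathcal F,\ u\in U),$$ where $p^{m}$-th roots are taken in an algebraic closure of $K$ (it is known that the value lies in $\mathbb{F}_p$). *)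

(* Defs.v *)
From HB Require Import structures.
From mathcomp Require Import all_boot all_order all_algebra all_fingroup.
From mathcomp Require Import all_solvable all_field.
From mathcomp Require Import mpoly boolp.

Set Implicit Arguments.
Unset Strict Implicit.
Unset Printing Implicit Defensive.

Import GRing.Theory.
Local Open Scope ring_scope.
Local Open Scope quotient_scope.

Definition moore (R : comNzRingType) (p n : nat) (a : 'I_n -> R) : R :=
  \det (\matrix_(i < n, j < n) a j ^+ (p ^ i)).

Definition hat_moore (R : comNzRingType) (p n : nat) (f : 'I_n -> R)
    (i : 'I_n) : R :=
  moore p (fun j : 'I_n.-1 => f (lift i j)).

Definition Fp_comb (V : zmodType) (p n : nat) (eps : 'rV['F_p]_n)
    (v : 'I_n -> V) : V :=
  \sum_i v i *+ (eps 0 i).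

Definition Fp_span (V : zmodType) (p n : nat) (v : 'I_n -> V) : seq V :=
  undup [seq Fp_comb eps v | eps : 'rV['F_p]_n].

Section ArtinSchreierAlgebra.
Variables (K : fieldType) (p : nat).

Definition AS_rel n (f : 'I_n -> K) (k : 'I_n) : {mpoly K[n]} :=
  'X_k ^+ p - 'X_k - (f k)%:MP.

(* Having p prime as an argument is what makes the ideal provably proper, as
   {ideal_quot _} requires. *)
Definition AS_ideal (pcharK : p \in [pchar K]) n (f : 'I_n -> K) :
    {pred {mpoly K[n]}} :=
  fun g => `[< exists h : 'I_n -> {mpoly K[n]}, g = \sum_k h k * AS_rel f k >].

Fact AS_model (p_gt1 : (1 < p)%N) n (f : 'I_n -> K) :
  exists (C : comNzRingType) (phi : {rmorphism K -> C}) (c : 'I_n -> C),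
    forall k, c k ^+ p - c k - phi (f k) = 0.
Proof.
elim: n f => [|n IHn] f.
  by exists K, idfun, (fun=> 0) => -[].
have [C [phi [c cP]]] := IHn (fun k => f (lift ord0 k)).
pose h : {poly C} := 'X^p - ('X + (phi (f ord0))%:P).
have sX : (size ('X + (phi (f ord0))%:P)%R < size ('X^p : {poly C}))%N.
  by rewrite size_XaddC size_polyXn.
have sh : size h = p.+1 by rewrite /h size_polyDl ?size_polyN // size_polyXn.
have mh : h \is monic.
  by rewrite monicE /h lead_coefDl ?size_polyN // lead_coefXn.
exists {poly %/ h}, (qpolyC h \o phi),
  (fun k => if unlift ord0 k is Some j then qpolyC h (c j) else 'qX).
move=> k; case: unliftP => [j|] -> /=.
  by rewrite -rmorphXn -!rmorphB cP rmorph0.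
have -> : qpolyC h (phi (f ord0)) = in_qpoly h (phi (f ord0))%:P.
  apply/val_inj; rewrite /= Pdiv.CommonRing.rmodp_small //.
  by rewrite (leq_ltn_trans (size_polyC_leq1 _)) // size_mk_monic_gt1.
rewrite /qpolyX -rmorphXn -!rmorphB -addrA -opprD -/h.
apply/val_inj => /=.
by rewrite /mk_monic sh ltnS (ltnW p_gt1) mh /= Pdiv.RingMonic.rmodpp.
Qed.

Fact AS_ideal_closed (pcharK : p \in [pchar K]) n (f : 'I_n -> K) :
  idealr_closed (AS_ideal pcharK f).
Proof.
split.
- by apply/asboolP; exists (fun=> 0); rewrite big1 // => k _; rewrite mul0r.
- apply/asboolP => -[h]; move/prime_gt1: (pcharf_prime pcharK) => p_gt1.
  have [C [phi [c cP]]] := AS_model p_gt1 f.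
  move/(congr1 (mmap phi c)); rewrite rmorph1 rmorph_sum big1 => [/eqP|k _].
    by rewrite oner_eq0.
  rewrite rmorphM /AS_rel !rmorphB rmorphXn /= mmapX mmap1U mmapC cP.
  by rewrite mulr0.
- move=> a g g' /asboolP[h ->] /asboolP[h' ->]; apply/asboolP.
  exists (fun k => a * h k + h' k); rewrite mulr_sumr -big_split /=.
  by apply: eq_bigr => k _; rewrite mulrDl mulrA.
Qed.

HB.instance Definition _ (pcharK : p \in [pchar K]) n (f : 'I_n -> K) :=
  isIdealr.Build {mpoly K[n]} (AS_ideal pcharK f) (AS_ideal_closed pcharK f).

Definition AS_alg (pcharK : p \in [pchar K]) n (f : 'I_n -> K) : Type :=
  {ideal_quot (AS_ideal pcharK f)}.

HB.instance Definition _ (pcharK : p \in [pchar K]) n (f : 'I_n -> K) :=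
  GRing.ComNzRing.on (AS_alg pcharK f).

Variables (pcharK : p \in [pchar K]) (n : nat) (f : 'I_n -> K).
Local Notation A := (AS_alg pcharK f).

Definition AS_pi (g : {mpoly K[n]}) : A :=
  \pi_{ideal_quot (AS_ideal pcharK f)} g.

Definition AS_scale (k : K) (a : A) : A := AS_pi k%:MP * a.

Let AS_piD : {morph AS_pi : g h / g + h}. Proof. exact: rmorphD. Qed.
Let AS_piM : {morph AS_pi : g h / g * h}. Proof. exact: rmorphM. Qed.
Let AS_pi1 : AS_pi 1 = 1. Proof. exact: rmorph1. Qed.

Fact AS_scaleA a b v : AS_scale a (AS_scale b v) = AS_scale (a * b) v.
Proof. by rewrite /AS_scale mpolyCM AS_piM mulrA. Qed.
Fact AS_scale1 : left_id 1 AS_scale.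
Proof. by move=> v; rewrite /AS_scale mpolyC1 AS_pi1 mul1r. Qed.
Fact AS_scaleDr : right_distributive AS_scale +%R.
Proof. by move=> a u v; rewrite /AS_scale mulrDr. Qed.
Fact AS_scaleDl v : {morph AS_scale^~ v : a b / a + b}.
Proof. by move=> a b; rewrite /AS_scale mpolyCD AS_piD mulrDl. Qed.

HB.instance Definition _ := GRing.Zmodule_isLmodule.Build K A
  AS_scaleA AS_scale1 AS_scaleDr AS_scaleDl.

Fact AS_scaleAl (k : K) (u v : A) : k *: (u * v) = k *: u * v.
Proof. exact: mulrA. Qed.

HB.instance Definition _ := GRing.Lmodule_isLalgebra.Build K A AS_scaleAl.
HB.instance Definition _ := GRing.Lalgebra_isComAlgebra.Build K A.

Definition AS_gen (k : 'I_n) : A := AS_pi 'X_k.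

Definition AS_w : A :=
  \det (\matrix_(i < n, j < n)
          if (i : nat) == 0%N then AS_gen j else (f j ^+ (p ^ i.-1))%:A).

End ArtinSchreierAlgebra.

Definition AS_Q (K : fieldType) (p n : nat) (f : 'I_n -> K) : {poly K} :=
  (moore p (hat_moore p f))^-1 *:
    moore p (fun j : 'I_n.+1 =>
               if unlift ord_max j is Some i then (hat_moore p f i)%:P else 'X)
  - (moore p f ^+ (p ^ n.-1))%:P.

Section Subalgebras.
Variables (K : fieldType) (A : comAlgType K).

Definition is_subalg (V : A -> Prop) : Prop :=
  [/\ V 1, forall (k : K) a b, V a -> V b -> V (k *: a + b)
    & forall a b, V a -> V b -> V (a * b)].

Definition gen_alg (a : A) : A -> Prop :=
  fun b => exists g : {poly K}, b = horner_alg a g.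

(* {poly %/ h} is K[W]/(h) for h monic and nonconstant; 'qX is the class of W
   (the library replaces any other h by 'X). *)
Definition quot_iso (h : {poly K}) (V : A -> Prop) (a : A) : Prop :=
  exists phi : {lrmorphism {poly %/ h} -> A},
    [/\ injective phi, forall b, V b <-> exists q, b = phi q & phi 'qX = a].

Definition has_Kdim (V : A -> Prop) (d : nat) : Prop :=
  exists b : 'I_d -> A, (forall i, V (b i)) /\
    forall a, V a -> exists! c : 'rV[K]_d, a = \sum_i c 0 i *: b i.

Definition is_field : Prop := forall a : A, a != 0 -> exists b, a * b = 1.

Definition is_Kaut (s : A -> A) : Prop :=
  bijective s /\ exists phi : {lrmorphism A -> A}, s =1 phi.

Definition is_Kaut_subgroup (G : (A -> A) -> Prop) : Prop :=
  [/\ forall s, G s -> is_Kaut s, G id,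
      forall s t, G s -> G t -> G (s \o t)
    & forall s t, G s -> cancel s t -> cancel t s -> G t].

Definition iso_Zp_pow (p n : nat) (G : (A -> A) -> Prop) : Prop :=
  exists theta : 'rV['Z_p]_n -> A -> A,
    [/\ forall s, G s <-> exists v, s =1 theta v,
        forall v v', theta (v + v') =1 theta v \o theta v'
      & forall v v', theta v =1 theta v' -> v = v'].

Definition is_pcyclic_ext (p : nat) (V : A -> Prop) : Prop :=
  exists (E : splittingFieldType K) (phi : {lrmorphism E -> A}),
    [/\ forall a, V a <-> exists x, a = phi x, galois 1%AS {:E},
        cyclic 'Gal({:E} / 1%AS) & #|'Gal({:E} / 1%AS)%g| = p].

Definition has_card (P : (A -> Prop) -> Prop) (N : nat) : Prop :=
  exists s : 'I_N -> A -> Prop, (forall i, P (s i)) /\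
    forall V, P V -> exists! i, forall a, V a <-> s i a.

End Subalgebras.

Section Elkies.
Variables (K : fieldType) (p n : nat) (f : 'I_n -> K).

Definition span_poly : {poly K} := \prod_(x <- Fp_span p f) ('X - x%:P).

(* span_poly is an additive polynomial: its only monomials are the 'X^(p ^ m)
   with m <= n, so these are the c_m of span_poly = \sum_m c_m X^(p^m). *)
Definition span_coef (m : nat) : K := span_poly`_(p ^ m).

Definition rev_span_poly : {poly K} :=
  \sum_(m < n.+1) (span_coef (n - m) ^+ (p ^ m)) *: 'X^(p ^ m).

Definition spaceU : seq K :=
  [seq (z / moore p f) ^+ p | z <- Fp_span p (hat_moore p f)].

Fact closed_root_subproof (L : closedFieldType) (d : nat) (x : L) :
  exists y, (0 < d)%N ==> (y ^+ d == x).
Proof.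
case: d => [|d]; first by exists 0.
have [y yP] := @solve_monicpoly L d.+1 (fun i => if i is 0%N then x else 0) isT.
by exists y; rewrite yP big_ord_recl big1 ?expr0 ?mulr1 ?addr0 //= => i _;
  rewrite mul0r.
Qed.

(* A d-th root; it is unique when d is a power of the characteristic. *)
Definition closed_root (L : closedFieldType) (d : nat) (x : L) : L :=
  xchoose (closed_root_subproof d x).

(* The formula takes its value in L; for x in the span of f and u in spaceU
   that value lies in the prime field. *)
Definition elkies (L : closedFieldType) (iota : K -> L) (x u : K) : L :=
  \sum_(1 <= m < n.+1) \sum_(j < m)
    (closed_root (p ^ m) (iota (span_coef m * u)) * iota x) ^+ (p ^ j).

End Elkies.

Definition is_alg_closure (K : fieldType) (L : closedFieldType)
    (iota : K -> L) : Prop :=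
  forall x : L, algebraicOver iota x.

(* dim_{F_p} (V / W) = r, for W <= V additive subgroups of K. *)
Definition has_Fp_quot_dim (K : fieldType) (p : nat) (V W : K -> Prop)
    (r : nat) : Prop :=
  exists b : 'I_r -> K, (forall i, V (b i)) /\
    forall x, V x -> exists! c : 'rV['F_p]_r, W (x - Fp_comb c b).

Definition AS_image (K : fieldType) (p : nat) (y : K) : Prop :=
  exists x, y = x ^+ p - x.

Definition proj_reps (p n : nat) (E : {set 'rV['F_p]_n}) : Prop :=
  0 \notin E /\
  forall v, v != 0 ->
    exists! e, e \in E /\ exists2 c : 'F_p, c != 0 & v = c *: e.

(* Main.v *)
Require Import Defs.
From HB Require Import structures.
From mathcomp Require Import all_boot all_order all_algebra all_fingroup.
From mathcomp Require Import all_solvable all_field.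
From mathcomp Require Import mpoly boolp zify.

Set Implicit Arguments.
Unset Strict Implicit.
Unset Printing Implicit Defensive.

Import GRing.Theory.
Local Open Scope ring_scope.

(* Let [H_j = (-1)^j h_j], where [h_j] is the [j]-th hatted Moore determinant.
   The [H_j] are cofactors of the Moore matrix of [f], so that
   [sum_j H_j f_j^(p^i)] vanishes for [i < n - 1] and is [(-1)^(n-1) D] for
   [i = n - 1], where [D = moore p f].  Since [w = sum_j H_j w_j] and
   [w_j^p = w_j + f_j], the powers [w^(p^k)] are linear in the [w_j] with matrix
   the Moore matrix of [H].  Solving this system recovers the [w_j] from [w], and
   the equation [k = n] is [Q(w) = 0]; carried out in [K[W]/(Q)], the same
   computation gives the inverse isomorphism.  The automorphism [sigma z], for
   [z = sum_j H_j a_j], is the shift [w_j |-> w_j + a_j], [a] in [F_p^n].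

   The [p^n]-th power of the Elkies pairing involves no roots.  On the families
   [f_i] and [(H_k / D)^p] its matrix is a product of two square matrices whose
   product in the other order is scalar by the orthogonality above, so the
   pairing is [(-1)^(n-1)] times the standard dot product.  As its values are
   fixed by Frobenius, telescoping [E^p - E] shows that the elements of [U] are
   the roots of the reversed polynomial.

   If no nonzero [f_eps] has the form [x^p - x], let [g] be an irreducible
   factor of [Q] with a root [x0].  The [a] for which [x0 + sum_j H_j a_j] is a
   root of [g] form a subgroup [S] of order [deg g].  If [eps] annihilates [S],
   the image of [w_eps] in [K(x0)] is constant on the roots of [g], hence lies
   in [K], so [eps = 0].  Thus [S] is everything, [g = Q] and [A] is a field.  A
   [p]-cyclic subextension has an Artin-Schreier generator [y]; the shifts move
   [y] by a linear functional [a |-> a . eps], and [y - w_eps] is invariant,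
   hence in [K]. *)

(** * Powers of Frobenius and prime field scalars *)

Section FrobeniusPower.
Variables (R : comNzRingType) (p : nat) (pcharR : p \in [pchar R]).

(** The characteristic proof is an argument so that a ring morphism structure can be attached; the
    [exprp] lemmas of this section are then generic morphism lemmas. *)
Definition frobn (_ : p \in [pchar R]) (k : nat) (x : R) : R := x ^+ (p ^ k).

Let pcharR_nat k : [pchar R].-nat (p ^ k)%N.
Proof.
by rewrite (eq_pnat _ (pcharf_eq pcharR)) pnatX pnat_id ?(pcharf_prime pcharR).
Qed.

Fact frobn_is_nmod_morphism k : nmod_morphism (frobn pcharR k).
Proof.
split; last by move=> x y; rewrite /frobn exprDn_pchar.
by rewrite /frobn expr0n expn_eq0 eqn0Ngt (prime_gt0 (pcharf_prime pcharR)).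
Qed.

Fact frobn_is_monoid_morphism k : monoid_morphism (frobn pcharR k).
Proof. by split=> [|x y]; rewrite /frobn ?expr1n ?exprMn. Qed.

HB.instance Definition _ k :=
  GRing.isNmodMorphism.Build R R (frobn pcharR k) (frobn_is_nmod_morphism k).
HB.instance Definition _ k :=
  GRing.isMonoidMorphism.Build R R (frobn pcharR k)
    (frobn_is_monoid_morphism k).

Lemma exprpD k (x y : R) : (x + y) ^+ (p ^ k) = x ^+ (p ^ k) + y ^+ (p ^ k).
Proof. exact: (rmorphD (frobn pcharR k)). Qed.

Lemma exprpB k (x y : R) : (x - y) ^+ (p ^ k) = x ^+ (p ^ k) - y ^+ (p ^ k).
Proof. exact: (rmorphB (frobn pcharR k)). Qed.

Lemma exprp0 k : 0 ^+ (p ^ k) = 0 :> R.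
Proof. exact: (rmorph0 (frobn pcharR k)). Qed.

Lemma exprp_sum k (I : Type) (r : seq I) (P : pred I) (F : I -> R) :
  (\sum_(i <- r | P i) F i) ^+ (p ^ k) = \sum_(i <- r | P i) F i ^+ (p ^ k).
Proof. exact: (rmorph_sum (frobn pcharR k)). Qed.

Lemma exprp_det k m (M : 'M[R]_m) :
  (\det M) ^+ (p ^ k) = \det (\matrix_(i, j) M i j ^+ (p ^ k)).
Proof.
rewrite -[LHS](det_map_mx (frobn pcharR k)); congr (\det _).
by apply/matrixP=> i j; rewrite !mxE.
Qed.

Lemma exprp_nat k c : (c%:R : R) ^+ (p ^ k) = c%:R.
Proof. exact: (rmorph_nat (frobn pcharR k)). Qed.

Lemma exprp_sign k c : ((-1) ^+ c : R) ^+ (p ^ k) = (-1) ^+ c.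
Proof. exact: (rmorph_sign (frobn pcharR k)). Qed.

Lemma exprpMn k (x : R) c : (x *+ c) ^+ (p ^ k) = x ^+ (p ^ k) *+ c.
Proof. exact: (rmorphMn (frobn pcharR k)). Qed.

End FrobeniusPower.

Lemma exprp_inj (R : idomainType) (p k : nat) :
  p \in [pchar R] -> injective (fun x : R => x ^+ (p ^ k)).
Proof.
move=> pcharR x y /= /eqP; rewrite -subr_eq0 -exprpB //.
by rewrite expf_eq0 subr_eq0 => /andP[_ /eqP].
Qed.

Section PrimeFieldScalars.
Variables (R : nzRingType) (p : nat) (pcharR : p \in [pchar R]).

(** The ring morphism from the prime field, given by natural representatives so as to match the [*+]
    in [Fp_comb]. *)
Definition Fpr (_ : p \in [pchar R]) (x : 'F_p) : R := (x : nat)%:R.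

Let p_pr := pcharf_prime pcharR.

Lemma Fpr_nat c : Fpr pcharR c%:R = c%:R.
Proof. by rewrite /Fpr val_Fp_nat // (GRing.natr_mod_pchar pcharR). Qed.

Let Fp_natE (x : 'F_p) : x = (x : nat)%:R.
Proof. by rewrite natr_Zp. Qed.

Fact Fpr_is_nmod_morphism : nmod_morphism (Fpr pcharR).
Proof.
split=> [|x y]; first by rewrite -[0]/(0%:R) Fpr_nat.
by rewrite {1}[x]Fp_natE {1}[y]Fp_natE -natrD Fpr_nat natrD.
Qed.

Fact Fpr_is_monoid_morphism : monoid_morphism (Fpr pcharR).
Proof.
split=> [|x y]; first by rewrite -[1]/(1%:R) Fpr_nat.
by rewrite {1}[x]Fp_natE {1}[y]Fp_natE -natrM Fpr_nat natrM.
Qed.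

HB.instance Definition _ :=
  GRing.isNmodMorphism.Build 'F_p R (Fpr pcharR) Fpr_is_nmod_morphism.
HB.instance Definition _ :=
  GRing.isMonoidMorphism.Build 'F_p R (Fpr pcharR) Fpr_is_monoid_morphism.

Lemma Fp_combE n (eps : 'rV['F_p]_n) (v : 'I_n -> R) :
  Fp_comb eps v = \sum_i Fpr pcharR (eps 0 i) * v i.
Proof. by apply: eq_bigr => i _; rewrite mulr_natl. Qed.

Lemma Fp_comb0 n (v : 'I_n -> R) : Fp_comb (0 : 'rV['F_p]_n) v = 0.
Proof.
by rewrite Fp_combE big1 // => i _; rewrite mxE rmorph0 mul0r.
Qed.

Lemma Fp_combD n (e1 e2 : 'rV['F_p]_n) (v : 'I_n -> R) :
  Fp_comb (e1 + e2) v = Fp_comb e1 v + Fp_comb e2 v.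
Proof.
rewrite !Fp_combE -big_split; apply: eq_bigr => i _ /=.
by rewrite mxE rmorphD mulrDl.
Qed.

Lemma Fp_combN n (e : 'rV['F_p]_n) (v : 'I_n -> R) :
  Fp_comb (- e) v = - Fp_comb e v.
Proof.
rewrite !Fp_combE -sumrN; apply: eq_bigr => i _ /=.
by rewrite mxE rmorphN mulNr.
Qed.

Lemma Fp_combZ n c (e : 'rV['F_p]_n) (v : 'I_n -> R) :
  Fp_comb (c *: e) v = Fpr pcharR c * Fp_comb e v.
Proof.
rewrite !Fp_combE mulr_sumr; apply: eq_bigr => i _ /=.
by rewrite mxE rmorphM mulrA.
Qed.

Lemma Fp_comb_inj n (v : 'I_n -> R) :
  (forall e : 'rV['F_p]_n, Fp_comb e v = 0 -> e = 0) ->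
  injective (fun e : 'rV['F_p]_n => Fp_comb e v).
Proof.
move=> ker0 e1 e2 /= e12; apply/eqP; rewrite -subr_eq0; apply/eqP/ker0.
by rewrite Fp_combD Fp_combN e12 subrr.
Qed.

End PrimeFieldScalars.

Lemma Fpr_frob (R : comNzRingType) (p : nat) (pcharR : p \in [pchar R]) x :
  Fpr pcharR x ^+ p = Fpr pcharR x.
Proof. by have := exprp_nat pcharR 1 x; rewrite expn1. Qed.

Lemma Fp_spanP (V : zmodType) (p n : nat) (v : 'I_n -> V) x :
  reflect (exists eps : 'rV['F_p]_n, x = Fp_comb eps v) (x \in Fp_span p v).
Proof.
rewrite mem_undup; apply: (iffP imageP) => [[e _ ->]|[e ->]]; by exists e.
Qed.

Lemma size_Fp_span (V : zmodType) (p n : nat) (v : 'I_n -> V) :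
  prime p -> injective (fun eps : 'rV['F_p]_n => Fp_comb eps v) ->
  size (Fp_span p v) = (p ^ n)%N.
Proof.
move=> p_pr v_inj; rewrite /Fp_span undup_id; last first.
  by rewrite (map_inj_uniq v_inj) enum_uniq.
by rewrite size_map -cardE card_mx card_Fp // mul1n.
Qed.

Lemma exprp_Fp_comb (R : comNzRingType) (p k n : nat) (eps : 'rV['F_p]_n)
    (v : 'I_n -> R) : p \in [pchar R] ->
  Fp_comb eps v ^+ (p ^ k) = Fp_comb eps (fun i => v i ^+ (p ^ k)).
Proof.
move=> pcharR; rewrite exprp_sum //.
by apply: eq_bigr => i _; rewrite exprpMn.
Qed.

(** * Moore determinants and their cofactors *)

Section Moore.
Variables (K : fieldType) (p : nat) (pcharK : p \in [pchar K]).
Let p_pr := pcharf_prime pcharK.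

(** Frobenius fixes the coefficients of an ['F_p]-linear relation, so the powers of the relation say
    that the Moore matrix kills the coefficient vector. *)
Lemma moore_neq0_inj n (a : 'I_n -> K) :
  moore p a != 0 -> injective (fun eps : 'rV['F_p]_n => Fp_comb eps a).
Proof.
move=> a_neq0; apply: (Fp_comb_inj pcharK) => e e_a.
pose M := \matrix_(i < n, j < n) a j ^+ (p ^ i).
pose c := \col_(i < n) Fpr pcharK (e 0 i).
have Mc : M *m c = 0.
  apply/matrixP=> i j; rewrite !mxE.
  transitivity (Fp_comb e a ^+ (p ^ i)).
    rewrite (exprp_Fp_comb _ _ _ pcharK) (Fp_combE pcharK).
    by apply: eq_bigr => k _; rewrite !mxE mulrC.
  by rewrite e_a exprp0.
have uM : M \in unitmx by rewrite unitmxE unitfE.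
have c0 : c = 0 by rewrite -[c](mulKmx uM) Mc mulmx0.
apply/rowP=> i; rewrite mxE; apply: (fmorph_inj (Fpr pcharK)).
by move/matrixP/(_ i 0): c0; rewrite !mxE rmorph0.
Qed.

(* Expansion along the last column. *)
Lemma moore_polyE n (a : 'I_n -> K) : moore p a != 0 ->
  exists l : nat -> K,
    [/\ l n = 1,
        (moore p a)^-1 *: moore p (fun j : 'I_n.+1 =>
            if unlift ord_max j is Some i then (a i)%:P else 'X)
          = \sum_(m < n.+1) l m *: 'X^(p ^ m)
      & forall j, \sum_(m < n.+1) l m * a j ^+ (p ^ m) = 0].
Proof.
move=> a_neq0.
set b := fun j : 'I_n.+1 => if unlift ord_max j is Some i then (a i)%:P else 'X.
pose c (m : 'I_n.+1) : K :=
  (-1) ^+ (m + n) * \det (\matrix_(i < n, j < n) a j ^+ (p ^ lift m i)).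
have bE : moore p b = \sum_(m < n.+1) c m *: 'X^(p ^ m).
  rewrite /moore (expand_det_col _ ord_max); apply: eq_bigr => m _.
  rewrite !mxE /b unlift_none mulrC -mul_polyC; congr (_ * _).
  rewrite /cofactor /c rmorphM rmorphXn rmorphN1 /=; congr (_ * _).
  rewrite -det_map_mx; congr (\det _); apply/matrixP=> i j.
  by rewrite !mxE liftK rmorphXn.
have cn : c ord_max = moore p a.
  rewrite /c /moore addnn -mul2n exprM sqrrN !expr1n mul1r; congr (\det _).
  by apply/matrixP=> i j; rewrite !mxE lift_max.
pose l m := (moore p a)^-1 * c (inord m).
have lE (m : 'I_n.+1) : l m = (moore p a)^-1 * c m by rewrite /l inord_val.
exists l; split.
- by rewrite -[n in l n]/(nat_of_ord (@ord_max n)) lE cn mulVf.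
- by rewrite bE scaler_sumr; apply: eq_bigr => m _; rewrite scalerA lE.
move=> j; transitivity ((moore p a)^-1 * (moore p b).[a j]).
  rewrite bE horner_sum mulr_sumr; apply: eq_bigr => m _.
  by rewrite lE hornerZ hornerXn -mulrA.
(* At [a j] the last column coincides with the column of [a j], so the determinant vanishes. *)
suff -> : (moore p b).[a j] = 0 by rewrite mulr0.
rewrite -[_.[_]]/(horner_eval (a j) _) -det_map_mx -det_tr.
apply: (@determinant_alternate _ _ _ (lift ord_max j) ord_max).
  by rewrite eq_sym neq_lift.
move=> m; rewrite !mxE /b liftK unlift_none.
by rewrite !rmorphXn /= /horner_eval hornerC hornerX.
Qed.

End Moore.

Section Duality.
Variables (K : fieldType) (p : nat) (pcharK : p \in [pchar K]).
Variables (n : nat) (f : 'I_n.+1 -> K).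
Let p_pr := pcharf_prime pcharK.
Local Notation D := (moore p f).

Definition cohat (j : 'I_n.+1) : K := (-1) ^+ j * hat_moore p f j.
Local Notation H := cohat.

Lemma cohat_exp k j : H j ^+ (p ^ k) = (-1) ^+ j * hat_moore p f j ^+ (p ^ k).
Proof. by rewrite exprMn exprp_sign. Qed.

(** Frobenius raises both indices at once, so every value is a power of one whose smaller index is
    zero. *)
Definition pairing (k i : nat) : K := \sum_j H j ^+ (p ^ k) * f j ^+ (p ^ i).

Lemma pairing_exp k i d : pairing k i ^+ (p ^ d) = pairing (k + d) (i + d).
Proof.
rewrite exprp_sum //; apply: eq_bigr => j _.
by rewrite exprMn -!exprM -!expnD.
Qed.

Let M := \matrix_(i < n.+1, j < n.+1) f j ^+ (p ^ i).

(** By the adjugate identity, the cofactors of the last row of [M] are orthogonal to every other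
    row. *)
Let pairing0 d : (d <= n)%N -> pairing 0 d = ((-1) ^+ n * D) *+ (d == n).
Proof.
rewrite -ltnS => lt_dn; pose i := Ordinal lt_dn.
have /matrixP/(_ i ord_max) := mul_mx_adj M; rewrite !mxE => DE.
rewrite -mulrnAr -[D *+ _]DE mulr_sumr; apply: eq_bigr => j _.
rewrite !mxE expn0 expr1 [LHS]mulrC [RHS]mulrCA; congr (_ * _).
rewrite /cofactor mulrA -exprD addnA addnn exprD -mul2n exprM sqrrN !expr1n mul1r.
congr (_ * _); rewrite /hat_moore /moore; congr (\det _).
by apply/matrixP=> a b; rewrite !mxE lift_max.
Qed.

Lemma pairing_eq0 k i : (k <= i < k + n)%N -> pairing k i = 0.
Proof.
case/andP=> le_ki lt_ik; rewrite -(subnK le_ki) -(pairing_exp 0) pairing0; last lia.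
have /negPf -> : (i - k)%N != n by lia.
by rewrite mulr0n exprp0.
Qed.

Lemma pairing_top k : pairing k (k + n) = ((-1) ^+ n * D) ^+ (p ^ k).
Proof. by rewrite addnC -(pairing_exp 0) pairing0 ?eqxx. Qed.

(** Reduces to [k = 0]: the [p]-th powers of the [H j] are the cofactors of the first row, since
    deleting that row leaves the Frobenius image of a Moore matrix. *)
Lemma pairing_low k : pairing k.+1 k = D ^+ (p ^ k).
Proof.
rewrite -[k.+1]add1n -(pairing_exp 1 0); congr (_ ^+ _).
rewrite [RHS](expand_det_row _ ord0); apply: eq_bigr => j _.
rewrite cohat_exp mxE mulrC /cofactor; congr (_ * _); rewrite ?add0n.
congr (_ * _); rewrite /hat_moore /moore exprp_det //; congr (\det _).
by apply/matrixP=> a b; rewrite !mxE /= -exprM -expnSr.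
Qed.

Variable c : nat -> K.
Hypothesis c_top : c n.+1 = 1.
Hypothesis c_f : forall j, \sum_(m < n.+2) c m * f j ^+ (p ^ m) = 0.

(** The upper part of the [p ^ q]-th power of the relation [c_f], cut where the exponent of [f j]
    reaches [p ^ n.+1]. By [elkiesK_dualC] it is the coefficient of [t ^+ (p ^ q.+1)] in the twisted
    Elkies pairing of [f j] with [t ^+ p]. *)
Definition dualC (q : nat) (j : 'I_n.+1) : K :=
  \sum_(m < n.+2 | (n.+1 <= m + q)%N) c m ^+ (p ^ q) * f j ^+ (p ^ (m + q)).

(** Apply [pairing_eq0] term by term. For [q < q'] every term vanishes. For [q > q'] the terms left
    out of [dualC] vanish too, and adding them back completes a power of the relation [c_f]. For
    [q = q'] only the top index [m = n.+1] survives. *)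
Lemma dualC_pairing q q' : (q <= n)%N -> (q' <= n)%N ->
  \sum_j dualC q j * H j ^+ (p ^ q'.+1) =
  ((-1) ^+ n * D) ^+ (p ^ q.+1) *+ (q == q').
Proof.
move=> le_qn le_q'n.
have pairE (P : pred 'I_n.+2) :
    \sum_j (\sum_(m < n.+2 | P m) c m ^+ (p ^ q) * f j ^+ (p ^ (m + q)))
           * H j ^+ (p ^ q'.+1)
    = \sum_(m < n.+2 | P m) c m ^+ (p ^ q) * pairing q'.+1 (m + q).
  under eq_bigr do rewrite mulr_suml.
  rewrite exchange_big; apply: eq_bigr => m _ /=; rewrite mulr_sumr.
  by apply: eq_bigr => j _; rewrite -mulrA [f j ^+ _ * _]mulrC.
rewrite /dualC pairE; have [lt_qq'|lt_q'q|<-{q' le_q'n pairE}] := ltngtP q q'.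
- rewrite big1 // => m le_m; rewrite pairing_eq0 ?mulr0 //.
  by have := ltn_ord m; lia.
- apply/eqP; rewrite mulr0n -[X in X == _]addr0.
  rewrite -[X in _ + X](_ : \sum_(m < n.+2 | ~~ (n.+1 <= m + q)%N)
     c m ^+ (p ^ q) * pairing q'.+1 (m + q) = 0); last first.
    by rewrite big1 // => m lt_m; rewrite pairing_eq0 ?mulr0 //; lia.
  rewrite -[X in X == _](bigID (fun m : 'I_n.+2 => (n.+1 <= m + q)%N) xpredT).
  rewrite -(pairE xpredT) big1 // => j _.
  transitivity ((\sum_(m < n.+2) c m * f j ^+ (p ^ m)) ^+ (p ^ q)
     * H j ^+ (p ^ q'.+1)); last by rewrite c_f exprp0 ?mul0r.
  congr (_ * _); rewrite exprp_sum //; apply: eq_bigr => m _.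
  by rewrite exprMn -exprM -expnD.
rewrite (bigD1 ord_max) /=; last by rewrite leq_addr.
rewrite c_top expr1n mul1r addSnnS addnC pairing_top big1 ?addr0 ?mulr1n //.
move=> m /andP[le_m ne_m]; rewrite pairing_eq0 ?mulr0 //.
by have := ltn_ord m; move: ne_m; rewrite -val_eqE /=; lia.
Qed.

Hypothesis D_neq0 : D != 0.

Let cD q : ((-1) ^+ n * D) ^+ (p ^ q) != 0.
Proof. by rewrite expf_eq0 mulf_eq0 signr_eq0 (negPf D_neq0) andbF. Qed.

Let Cmx := \matrix_(q < n.+1, j < n.+1) dualC q j.
Let Hmx := \matrix_(q < n.+1, j < n.+1) H j ^+ (p ^ q.+1).

Let CHmx : Cmx *m Hmx^T = diag_mx (\row_q ((-1) ^+ n * D) ^+ (p ^ q.+1)).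
Proof.
apply/matrixP=> q q'; rewrite !mxE -dualC_pairing -1?ltnS ?ltn_ord //.
by apply: eq_bigr => j _; rewrite !mxE.
Qed.

(** By [CHmx], [Hmx] is a factor of an invertible diagonal matrix; up to column signs its
    determinant is the [p]-th power of the Moore determinant of the minors. *)
Lemma moore_hat_neq0 : moore p (hat_moore p f) != 0.
Proof.
have /eqP := congr1 determinant CHmx; rewrite det_mulmx det_diag det_tr.
apply: contraTneq => h0; suff -> : \det Hmx = 0.
  rewrite mulr0 eq_sym; apply/prodf_neq0 => q _; rewrite mxE; exact: cD.
have -> : Hmx = \matrix_(q, j) hat_moore p f j ^+ (p ^ q.+1)
                *m diag_mx (\row_j (-1) ^+ nat_of_ord j).
  by rewrite mul_mx_diag; apply/matrixP=> q j; rewrite !mxE cohat_exp mulrC.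
rewrite det_mulmx; apply/eqP; rewrite mulf_eq0; apply/orP; left.
suff -> : \matrix_(q < n.+1, j < n.+1) hat_moore p f j ^+ (p ^ q.+1) =
    \matrix_(q, j) (\matrix_(q < n.+1, j < n.+1) hat_moore p f j ^+ (p ^ q)) q j
                    ^+ (p ^ 1).
  by rewrite -exprp_det // -/(moore p (hat_moore p f)) h0 exprp0.
by apply/matrixP=> q j; rewrite !mxE -exprM -expnD addn1.
Qed.

(* A one-sided inverse of a square matrix is two-sided; this turns the
   orthogonality over [j] into an orthogonality over [q]. *)
Lemma dualC_orthogonal i k :
  \sum_(q < n.+1) (H k / D) ^+ (p ^ q.+1) * dualC q i = ((-1) ^+ n) *+ (k == i).
Proof.
pose Tmx := \matrix_(q < n.+1, j < n.+1) (H j / D) ^+ (p ^ q.+1).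
have CT : Cmx *m ((-1) ^+ n *: Tmx^T) = 1%:M.
  apply/matrixP=> q q'; rewrite !mxE.
  transitivity ((-1) ^+ n / D ^+ (p ^ q'.+1) *
                \sum_j dualC q j * H j ^+ (p ^ q'.+1)).
    rewrite mulr_sumr; apply: eq_bigr => j _; rewrite !mxE exprMn exprVn.
    by rewrite mulrCA -!mulrA; congr (_ * _); rewrite mulrA mulrC.
  rewrite dualC_pairing -1?ltnS ?ltn_ord //.
  rewrite -[(q : nat) == q']/(q == q').
  have [->|ne_q] := eqVneq q q'; last by rewrite mulr0.
  rewrite !mulr1n exprMn exprp_sign // mulrACA -signr_odd -expr2 sqrr_sign.
  by rewrite mulVf ?mulr1 // expf_neq0.
have /matrixP/(_ k i) := mulmx1C CT; rewrite !mxE => /(congr1 ( *%R ((-1) ^+ n))).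
rewrite -mulr_natr => <-; rewrite mulr_sumr; apply: eq_bigr => q _.
by rewrite !mxE !mulrA -expr2 -exprM muln2 -mul2n exprM sqrrN !expr1n mul1r.
Qed.

End Duality.

Lemma additive_Fp_comb (V W : zmodType) (phi : V -> W) (p n : nat)
    (eps : 'rV['F_p]_n) (v : 'I_n -> V) :
  {morph phi : x y / x + y} ->
  phi (Fp_comb eps v) = Fp_comb eps (fun i => phi (v i)).
Proof.
move=> phiD; have phi0 : phi 0 = 0.
  by apply: (addrI (phi 0)); rewrite -phiD !addr0.
rewrite /Fp_comb (big_morph phi phiD phi0); apply: eq_bigr => i _.
by elim: (nat_of_ord _) => [|c IHc]; rewrite ?mulr0n // !mulrS phiD IHc.
Qed.

(** * Additive polynomials and the polynomial of a span *)

Section AdditivePolynomial.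
Variables (K : fieldType) (p : nat) (pcharK : p \in [pchar K]).
Let p_pr := pcharf_prime pcharK.

Definition addpoly n (l : nat -> K) : {poly K} :=
  \sum_(m < n.+1) l m *: 'X^(p ^ m).

Lemma horner_addpoly n l x :
  (addpoly n l).[x] = \sum_(m < n.+1) l m * x ^+ (p ^ m).
Proof.
by rewrite horner_sum; apply: eq_bigr => m _; rewrite hornerZ hornerXn.
Qed.

Lemma addpolyD n l : {morph horner (addpoly n l) : x y / x + y}.
Proof.
move=> x y; rewrite !horner_addpoly -big_split; apply: eq_bigr => m _ /=.
by rewrite exprpD // mulrDr.
Qed.

Lemma coef_addpoly n l m : (m <= n)%N -> (addpoly n l)`_(p ^ m) = l m.
Proof.
rewrite -ltnS => lt_m; rewrite coef_sum (bigD1 (Ordinal lt_m)) //= big1.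
  by rewrite coefZ coefXn eqxx mulr1 addr0.
move=> i; rewrite -val_eqE /= => ne_i; rewrite coefZ coefXn.
by rewrite eqn_exp2l ?prime_gt1 // eq_sym (negPf ne_i) mulr0.
Qed.

Lemma size_addpoly_leq n l : (size (addpoly n l) <= (p ^ n).+1)%N.
Proof.
apply: (leq_trans (size_sum _ _ _)); apply/bigmax_leqP => m _.
apply: (leq_trans (size_scale_leq _ _)); rewrite size_polyXn ltnS.
by rewrite leq_exp2l ?prime_gt1 // -ltnS.
Qed.

Lemma size_addpoly n l : l n = 1 -> size (addpoly n l) = (p ^ n).+1.
Proof.
move=> ln; apply/eqP; rewrite eqn_leq size_addpoly_leq /=.
by rewrite ltnNge; apply/negP => /leq_sizeP/(_ _ (leqnn _))/eqP;
  rewrite coef_addpoly // ln oner_eq0.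
Qed.

Lemma monic_addpoly n l : l n = 1 -> addpoly n l \is monic.
Proof.
by move=> ln; rewrite monicE /lead_coef size_addpoly // coef_addpoly //= ln.
Qed.

Lemma root_addpoly_span n l k (a : 'I_k -> K) x :
  (forall j, (addpoly n l).[a j] = 0) -> x \in Fp_span p a ->
  root (addpoly n l) x.
Proof.
move=> a0 /Fp_spanP[e ->]; apply/rootP.
rewrite (additive_Fp_comb _ _ (@addpolyD n l)) /Fp_comb big1 // => i _.
by rewrite a0 mul0rn.
Qed.

(** The degree is at most [p ^ n], so [p ^ n] distinct roots exhaust it. *)
Lemma addpoly_prod n l (rs : seq K) :
  addpoly n l != 0 -> all (root (addpoly n l)) rs -> uniq rs ->
  size rs = (p ^ n)%N ->
  addpoly n l = lead_coef (addpoly n l) *: \prod_(z <- rs) ('X - z%:P).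
Proof.
move=> nz rts urs srs; apply: all_roots_prod_XsubC; rewrite ?uniq_rootsE //.
by apply/eqP; rewrite eqn_leq max_poly_roots // srs size_addpoly_leq.
Qed.

Lemma span_poly_addpoly n (a : 'I_n -> K) l : moore p a != 0 ->
  l n = 1 -> (forall j, \sum_(m < n.+1) l m * a j ^+ (p ^ m) = 0) ->
  span_poly p a = addpoly n l.
Proof.
move=> a_neq0 ln la; have la' j : (addpoly n l).[a j] = 0.
  by rewrite horner_addpoly la.
have a_inj := moore_neq0_inj pcharK a_neq0.
rewrite (@addpoly_prod n l (Fp_span p a)).
- by rewrite (monicP (monic_addpoly ln)) scale1r.
- by rewrite monic_neq0 ?monic_addpoly.
- by apply/allP => x; apply: root_addpoly_span.
- exact: undup_uniq.
- exact: size_Fp_span.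
Qed.

(** The normalised determinant of [moore_polyE] is monic with the span as its set of roots, hence
    equals [span_poly]. This makes [span_coef] a valid choice for the sequence [c] of the
    duality. *)
Lemma span_coefP n (a : 'I_n -> K) : moore p a != 0 ->
  span_coef p a n = 1 /\
  (forall j, \sum_(m < n.+1) span_coef p a m * a j ^+ (p ^ m) = 0).
Proof.
move=> a_neq0; have [l [ln _ la]] := moore_polyE a_neq0.
have lE m : (m <= n)%N -> span_coef p a m = l m.
  by move=> le_m; rewrite /span_coef (span_poly_addpoly a_neq0 ln la) coef_addpoly.
split=> [|j]; first by rewrite lE.
by rewrite -[RHS](la j); apply: eq_bigr => m _; rewrite lE // -ltnS.
Qed.

End AdditivePolynomial.

(** * The Elkies pairing and the reversed polynomial *)

Section ElkiesPower.
Variables (K : fieldType) (p : nat) (pcharK : p \in [pchar K]).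
Let p_pr := pcharf_prime pcharK.

(* The [p ^ n]-th power of the Elkies pairing, which needs no roots. *)
Definition elkiesK n (c : nat -> K) (x u : K) : K :=
  \sum_(1 <= m < n.+1) \sum_(j < m)
    ((c m * u) ^+ (p ^ (n - m)) * x ^+ (p ^ n)) ^+ (p ^ j).

Lemma elkiesKDl n c u : {morph (elkiesK n c)^~ u : x y / x + y}.
Proof.
move=> x y; rewrite -big_split; apply: eq_bigr => m _ /=.
rewrite -big_split; apply: eq_bigr => j _ /=.
by rewrite (exprpD pcharK n) mulrDr (exprpD pcharK).
Qed.

Lemma elkiesKDr n c x : {morph elkiesK n c x : u v / u + v}.
Proof.
move=> u v; rewrite -big_split; apply: eq_bigr => m _ /=.
rewrite -big_split; apply: eq_bigr => j _ /=.
by rewrite mulrDr (exprpD pcharK) mulrDl (exprpD pcharK).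
Qed.

(** Frobenius sends the [j]-th inner term to the next one, so the inner sums telescope; the index
    [m = 0] can be included because it contributes zero. The upper ends assemble into the polynomial
    with coefficients [c] at [x], the lower ends, after reversing [m], into the reversed polynomial
    at [u]. *)
Lemma elkiesK_frob n c x u :
  elkiesK n c x u ^+ p - elkiesK n c x u =
  u ^+ (p ^ n) * (\sum_(m < n.+1) c m * x ^+ (p ^ m)) ^+ (p ^ n)
  - x ^+ (p ^ n) * \sum_(m < n.+1) c (n - m)%N ^+ (p ^ m) * u ^+ (p ^ m).
Proof.
pose T m j := ((c m * u) ^+ (p ^ (n - m)) * x ^+ (p ^ n)) ^+ (p ^ j).
have -> : elkiesK n c x u ^+ p = \sum_(1 <= m < n.+1) \sum_(j < m) T m j.+1.
  rewrite -[p in LHS]expn1 exprp_sum //; apply: eq_bigr => m _.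
  rewrite exprp_sum //; apply: eq_bigr => j _.
  by rewrite /T -exprM -expnD addn1.
rewrite -sumrB; transitivity (\sum_(0 <= m < n.+1) (T m m - T m 0)).
  rewrite [RHS]big_ltn // subrr add0r; apply: eq_bigr => m _.
  by rewrite -sumrB -(telescope_sumr (T m) (leq0n m)) big_mkord.
rewrite big_mkord sumrB; congr (_ - _).
  rewrite exprp_sum // mulr_sumr; apply: eq_bigr => m _.
  rewrite /T !exprMn -!exprM -!expnD subnK -1?ltnS ?ltn_ord //.
  by rewrite [(n + m)%N]addnC mulrAC mulrC.
rewrite mulr_sumr (reindex_inj rev_ord_inj); apply: eq_bigr => m _ /=.
rewrite /T expn0 expr1 exprMn mulrC subSS subKn //.
by rewrite -ltnS.
Qed.

End ElkiesPower.

(** Change of coordinates between the unsigned minors spanning [Z] and the signed cofactors [H]. *)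
Definition altv (p n : nat) (e : 'rV['F_p]_n) : 'rV['F_p]_n :=
  \row_j ((-1) ^+ j * e 0 j).

Definition dotv (p n : nat) (a e : 'rV['F_p]_n) : 'F_p := \sum_i a 0 i * e 0 i.

Lemma altvK p n : involutive (@altv p n).
Proof.
move=> e; apply/rowP=> j; rewrite !mxE mulrA -expr2 -exprM muln2 -mul2n.
by rewrite exprM sqrrN !expr1n mul1r.
Qed.

Section ElkiesValue.
Variables (K : fieldType) (p : nat) (pcharK : p \in [pchar K]).
Variables (n : nat) (f : 'I_n.+1 -> K).
Let p_pr := pcharf_prime pcharK.
Local Notation D := (moore p f).
Local Notation c := (span_coef p f).
Hypothesis D_neq0 : D != 0.

Lemma Fp_comb_altv (e : 'rV['F_p]_n.+1) :
  Fp_comb (altv e) (cohat p f) = Fp_comb e (hat_moore p f).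
Proof.
rewrite !(Fp_combE pcharK); apply: eq_bigr => j _; rewrite mxE rmorphM /=.
rewrite rmorph_sign mulrACA -expr2 -exprM muln2 -mul2n.
by rewrite exprM sqrrN !expr1n mul1r.
Qed.

(** Substitute [q = n.+1 - m + j]: the range [j < m] becomes [n.+1 <= m + q] with [q <= n], which is
    empty for [m = 0]. *)
Lemma elkiesK_dualC i (t : K) :
  elkiesK p n.+1 c (f i) (t ^+ p) =
  \sum_(q < n.+1) t ^+ (p ^ q.+1) * dualC p f c q i.
Proof.
rewrite /dualC; under [RHS]eq_bigr do rewrite mulr_sumr.
rewrite (exchange_big_dep xpredT) //= -(big_mkord xpredT
  (fun m => \sum_(q < n.+1 | (n < m + q)%N) t ^+ (p ^ q.+1) *
     (c m ^+ (p ^ q) * f i ^+ (p ^ (m + q))))).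
rewrite [RHS]big_ltn // [X in _ = X + _]big_pred0 ?add0r; last first.
  by move=> q; rewrite add0n ltnNge -ltnS ltn_ord.
apply: eq_big_nat => m /andP[m_gt0 le_m].
rewrite -(big_mkord (fun q => n < m + q)%N (fun q => t ^+ (p ^ q.+1) *
     (c m ^+ (p ^ q) * f i ^+ (p ^ (m + q))))).
rewrite (eq_bigl (fun q => (n.+1 - m <= q)%N)); last by move=> q /=; lia.
rewrite -(@big_nat_widenl _ _ _ _ _ _ xpredT) // -{2}[(n.+1 - m)%N]add0n.
rewrite big_addn subKn // big_mkord; apply: eq_bigr => j _.
have -> : (m + (j + (n.+1 - m)) = n.+1 + j)%N by lia.
rewrite !exprMn -!exprM -!expnD -expnS.
rewrite mulrA [c m ^+ _ * _]mulrC addnC; congr (t ^+ (p ^ _) * _ * _); lia.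
Qed.

Lemma elkiesKE (eps a : 'rV['F_p]_n.+1) :
  elkiesK p n.+1 c (Fp_comb eps f) ((Fp_comb a (cohat p f) / D) ^+ p) =
  Fpr pcharK ((-1) ^+ n * dotv a eps).
Proof.
have [c_top c_f] := span_coefP pcharK D_neq0.
have -> : (Fp_comb a (cohat p f) / D) ^+ p =
          Fp_comb a (fun k => (cohat p f k / D) ^+ p).
  apply: (additive_Fp_comb (phi := fun x => (x / D) ^+ p)) => x y.
  by rewrite mulrDl -[p in LHS]expn1 exprpD // expn1.
rewrite (additive_Fp_comb _ _ (elkiesKDl pcharK _ _ _)).
rewrite rmorphM rmorph_sign rmorph_sum mulr_sumr (Fp_combE pcharK).
apply: eq_bigr => i _.
rewrite (additive_Fp_comb _ _ (elkiesKDr pcharK _ _ _)) (Fp_combE pcharK).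
rewrite (bigD1 i) //= big1 => [|k ne_k].
  rewrite elkiesK_dualC dualC_orthogonal // eqxx mulr1n addr0 rmorphM.
  by rewrite mulrC mulrAC mulrC [_ * Fpr _ (eps _ _)]mulrC.
by rewrite elkiesK_dualC dualC_orthogonal // (negPf ne_k) mulr0.
Qed.

Lemma spaceUP x : reflect
  (exists a : 'rV['F_p]_n.+1, x = (Fp_comb a (cohat p f) / D) ^+ p)
  (x \in spaceU p f).
Proof.
apply: (iffP mapP) => [[z /Fp_spanP[e ->] ->]|[a ->]].
  by exists (altv e); rewrite Fp_comb_altv.
exists (Fp_comb a (cohat p f)) => //; apply/Fp_spanP.
by exists (altv a); rewrite -Fp_comb_altv altvK.
Qed.

Lemma rev_span_polyE : rev_span_poly p f =
  addpoly p n.+1 (fun m => span_coef p f (n.+1 - m) ^+ (p ^ m)).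
Proof. by []. Qed.

Lemma rev_span_poly_neq0 : rev_span_poly p f != 0.
Proof.
have [c_top _] := span_coefP pcharK D_neq0.
apply: contraNneq (oner_neq0 K) => R0.
have := coef_addpoly pcharK (fun m => c (n.+1 - m) ^+ (p ^ m)) (leq0n n.+1).
by rewrite -rev_span_polyE R0 coef0 /= subn0 expr1 c_top => <-.
Qed.

(** The twisted pairing takes values in the prime field, so the left side of [elkiesK_frob] is zero;
    the [f i] term vanishes as well, leaving a power of [f i] times the value of the reversed
    polynomial. Some [f i] is nonzero, as the Moore matrix has no zero row. *)
Lemma rev_span_poly_root x : x \in spaceU p f -> root (rev_span_poly p f) x.
Proof.
have [c_top c_f] := span_coefP pcharK D_neq0.
case/spaceUP=> a ->{x}; set u := (_ ^+ p).
have [i fi_neq0] : exists i, f i != 0.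
  apply/existsP; apply: contraNT D_neq0; rewrite negb_exists => /forallP f0.
  rewrite /moore (expand_det_row _ ord0) big1 // => j _; rewrite mxE.
  by have := f0 j; rewrite negbK => /eqP ->; rewrite exprp0 ?mul0r.
have fE : f i = Fp_comb (delta_mx 0 i : 'rV['F_p]_n.+1) f.
  rewrite (Fp_combE pcharK) (bigD1 i) //= big1 => [|j ne_j].
    by rewrite mxE !eqxx rmorph1 mul1r addr0.
  by rewrite mxE (negPf ne_j) andbF rmorph0 mul0r.
have := elkiesK_frob pcharK n.+1 c (f i) u; rewrite c_f exprp0 // mulr0 sub0r.
rewrite {1 2}fE elkiesKE // Fpr_frob subrr.
move/esym/eqP; rewrite oppr_eq0 mulf_eq0 expf_eq0 (negPf fi_neq0) andbF /=.
by rewrite rootE rev_span_polyE horner_addpoly.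
Qed.

Lemma rev_span_poly_prod : rev_span_poly p f =
  lead_coef (rev_span_poly p f) *: \prod_(u <- spaceU p f) ('X - u%:P).
Proof.
have h_neq0 : moore p (hat_moore p f) != 0.
  by have [c_top c_f] := span_coefP pcharK D_neq0; apply: moore_hat_neq0 c_f _.
rewrite rev_span_polyE; apply: addpoly_prod => //.
- by rewrite -rev_span_polyE rev_span_poly_neq0.
- by apply/allP => x /rev_span_poly_root.
- rewrite map_inj_uniq ?undup_uniq // => x y.
  rewrite -[p]expn1 => /(exprp_inj pcharK); apply: mulIf.
  by rewrite invr_eq0 expn1.
by rewrite size_map size_Fp_span //; apply: (moore_neq0_inj pcharK).
Qed.

Lemma root_rev_span_poly x : root (rev_span_poly p f) x = (x \in spaceU p f).
Proof.
rewrite rev_span_poly_prod rootZ ?root_prod_XsubC //.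
by rewrite lead_coef_eq0 rev_span_poly_neq0.
Qed.

(** The polynomial already splits over [K], so an extension brings no new root. *)
Lemma root_map_rev_span_poly (L : fieldType) (iota : {rmorphism K -> L}) y :
  root (map_poly iota (rev_span_poly p f)) y ->
  exists2 u, u \in spaceU p f & y = iota u.
Proof.
rewrite rev_span_poly_prod map_polyZ rootZ; last first.
  by rewrite fmorph_eq0 lead_coef_eq0 rev_span_poly_neq0.
rewrite map_prod_XsubC => /=.
rewrite -(big_map iota xpredT (fun z => 'X - z%:P)) root_prod_XsubC.
by case/mapP=> u; exists u.
Qed.

Section AlgebraicClosure.
Variables (L : closedFieldType) (iota : {rmorphism K -> L}).
Let pcharL : p \in [pchar L]. Proof. by rewrite (fmorph_pchar iota). Qed.

Lemma closed_rootK d (x : L) : (0 < d)%N -> closed_root d x ^+ d = x.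
Proof.
by move=> d_gt0; have /implyP/(_ d_gt0)/eqP := xchooseP (closed_root_subproof d x).
Qed.

Lemma closed_root_frob k (x : L) : closed_root (p ^ k) (x ^+ (p ^ k)) = x.
Proof.
by apply: (exprp_inj (k := k) pcharL); rewrite closed_rootK // expn_gt0 prime_gt0.
Qed.

(** Since [m <= n.+1], the outer power turns each [p ^ m]-th root into a [p ^ (n.+1 - m)]-th
    power. *)
Lemma elkies_exp x u :
  elkies p f iota x u ^+ (p ^ n.+1) = iota (elkiesK p n.+1 c x u).
Proof.
rewrite exprp_sum // rmorph_sum; apply: eq_big_nat => m /andP[m_gt0 le_m].
rewrite exprp_sum // rmorph_sum; apply: eq_bigr => j _.
rewrite -exprM mulnC exprM exprMn [RHS]rmorphXn; congr (_ ^+ _).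
rewrite [RHS]rmorphM !rmorphXn; congr (_ * _).
have -> : (p ^ n.+1 = p ^ m * p ^ (n.+1 - m))%N by rewrite -expnD subnKC.
by rewrite exprM closed_rootK // expn_gt0 prime_gt0.
Qed.

(** The outer power can be removed from [elkiesKE]: it is injective on [L] and fixes the prime
    field. *)
Lemma elkiesE (eps a : 'rV['F_p]_n.+1) :
  elkies p f iota (Fp_comb eps f) ((Fp_comb a (cohat p f) / D) ^+ p) =
  Fpr pcharL ((-1) ^+ n * dotv a eps).
Proof.
apply: (exprp_inj (k := n.+1) pcharL).
by rewrite elkies_exp elkiesKE /Fpr rmorph_nat exprp_nat.
Qed.

End AlgebraicClosure.
End ElkiesValue.

(** * Morphisms out of monogenic and Artin-Schreier algebras *)

Lemma horner_algZ (K : fieldType) (A : comAlgType K) (a : A) k g :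
  horner_alg a (k *: g) = k *: horner_alg a g.
Proof. by rewrite linearZ /= mulr_algl. Qed.

Section GeneratedAlgebra.
Variables (K : fieldType) (B A : comAlgType K).

Lemma lrmorphism_of (phi : B -> A) : linear phi -> monoid_morphism phi ->
  exists psi : {lrmorphism B -> A}, psi =1 phi.
Proof.
move=> phiL phiM.
pose lin := GRing.isSemilinear.Build K B A _ phi
  (GRing.semilinear_linear phiL).
pose mul := GRing.isMonoidMorphism.Build B A phi phiM.
by exists (HB.pack phi lin mul : {lrmorphism B -> A}).
Qed.

(** Each element is evaluated through a chosen polynomial in [x]; the kernel condition makes the
    result independent of the choice. *)
Lemma gen_alg_morph (x : B) (a : A) : (forall b, gen_alg x b) ->
  (forall g, horner_alg x g = 0 -> horner_alg a g = 0) ->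
  exists phi : {lrmorphism B -> A},
    forall g, phi (horner_alg x g) = horner_alg a g.
Proof.
move=> /choice[G GP] xa.
have GE g : horner_alg a (G (horner_alg x g)) = horner_alg a g.
  apply/eqP; rewrite -subr_eq0 -rmorphB; apply/eqP/xa.
  by rewrite rmorphB /= -GP subrr.
have [] := @lrmorphism_of (fun b => horner_alg a (G b)); last first.
- by move=> phi phiE; exists phi => g; rewrite phiE GE.
- split=> [|b c]; first by rewrite -(rmorph1 (horner_alg x)) GE rmorph1.
  have -> : b * c = horner_alg x (G b * G c) by rewrite rmorphM /= -!GP.
  by rewrite GE rmorphM.
- move=> k b c; have -> : k *: b + c = horner_alg x (k *: G b + G c).
    by rewrite rmorphD /= horner_algZ -!GP.
  by rewrite GE rmorphD /= horner_algZ.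
Qed.

Lemma lrmorph_horner (phi : {lrmorphism B -> A}) (x : B) g :
  phi (horner_alg x g) = horner_alg (phi x) g.
Proof.
elim/poly_ind: g => [|g c IH]; first by rewrite !rmorph0.
have hE (C : comAlgType K) (y : C) :
    horner_alg y (g * 'X + c%:P) = horner_alg y g * y + c%:A.
  by rewrite rmorphD rmorphM /= horner_algX horner_algC.
by rewrite !hE rmorphD rmorphM /= IH rmorph_alg.
Qed.

Lemma gen_alg_subalg (a : A) : is_subalg (gen_alg a).
Proof.
split=> [|k _ _ [g ->] [h ->]|_ _ [g ->] [h ->]].
- by exists 1; rewrite rmorph1.
- by exists (k *: g + h); rewrite rmorphD /= horner_algZ.
by exists (g * h); rewrite rmorphM.
Qed.

Lemma gen_alg_self (a : A) : gen_alg a a.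
Proof. by exists 'X; rewrite horner_algX. Qed.

Lemma horner_alg_comp (a : A) g h :
  horner_alg a (h \Po g) = horner_alg (horner_alg a g) h.
Proof.
elim/poly_ind: h => [|h k IH]; first by rewrite comp_poly0 !rmorph0.
rewrite comp_polyD comp_polyM comp_polyX comp_polyC !rmorphD !rmorphM /=.
by rewrite IH !horner_algX !horner_algC.
Qed.

Lemma gen_alg_trans (a b c : A) : gen_alg a b -> gen_alg b c -> gen_alg a c.
Proof. by case=> g -> [h ->]; exists (h \Po g); rewrite horner_alg_comp. Qed.

End GeneratedAlgebra.

Section QuotientPolynomial.
Variables (K : fieldType) (h : {poly K}).
Hypotheses (h_monic : h \is monic) (h_gt1 : (1 < size h)%N).

Lemma horner_qX g : horner_alg ('qX : {poly %/ h}) g = in_qpoly h g.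
Proof.
elim/poly_ind: g => [|g c IH]; first by rewrite !rmorph0.
rewrite !(rmorphD, rmorphM) /= IH horner_algX horner_algC -in_qpolyM.
congr (_ + _); apply/val_inj => /=.
by rewrite -mul_polyC mulr1 Pdiv.CommonRing.rmodp_small //
  (leq_ltn_trans (size_polyC_leq1 _)) // size_mk_monic_gt1.
Qed.

Lemma gen_qX (q : {poly %/ h}) : gen_alg 'qX q.
Proof.
exists (val q); rewrite horner_qX; apply/val_inj => /=.
by rewrite Pdiv.CommonRing.rmodp_small // size_mk_monic.
Qed.

Lemma horner_qX_eq0 g : horner_alg ('qX : {poly %/ h}) g = 0 <-> h %| g.
Proof.
rewrite horner_qX; have hE : mk_monic h = h by rewrite /mk_monic h_gt1 h_monic.
rewrite -[0](rmorph0 (in_qpoly h)); split=> [/(congr1 val)/=|].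
  rewrite hE Pdiv.CommonRing.rmod0p => /eqP.
  by rewrite Pdiv.Idomain.dvdpE.
rewrite Pdiv.Idomain.dvdpE => /eqP dvd.
by apply/val_inj; rewrite /= hE dvd Pdiv.CommonRing.rmod0p.
Qed.

(** Of the two implications in the kernel condition, one makes the morphism well defined and the
    other makes it injective. *)
Lemma quot_isoP (A : comAlgType K) (a : A) :
  (forall g, horner_alg a g = 0 <-> h %| g) -> quot_iso h (gen_alg a) a.
Proof.
move=> ha; have [|phi phiE] := @gen_alg_morph K {poly %/ h} A 'qX a gen_qX.
  by move=> g /horner_qX_eq0 /ha.
exists phi; split.
- apply: raddf_inj => q; have [g ->] := gen_qX q; rewrite /= phiE => /ha.
  by move/horner_qX_eq0.
- move=> b; split=> [[g ->]|[q ->]].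
    by exists (horner_alg 'qX g); rewrite phiE.
  by have [g ->] := gen_qX q; exists g; rewrite phiE.
by rewrite -{1}[qpolyX h]horner_algX phiE horner_algX.
Qed.

Lemma has_Kdim_gen (A : comAlgType K) (a : A) d : size h = d.+1 ->
  (forall g, horner_alg a g = 0 <-> h %| g) -> has_Kdim (gen_alg a) d.
Proof.
move=> hd ha; exists (fun i => a ^+ i); split.
  by move=> i; exists 'X^i; rewrite rmorphXn /= horner_algX.
have aE (c : 'rV[K]_d) : horner_alg a (rVpoly c) = \sum_i c 0 i *: a ^+ i.
  rewrite /rVpoly poly_def rmorph_sum /=; apply: eq_bigr => i _.
  by rewrite horner_algZ rmorphXn /= horner_algX valK.
have h_neq0 : h != 0 by rewrite monic_neq0.
move=> _ [g ->]; exists (poly_rV (g %% h)); split.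
  rewrite -aE poly_rV_K; last by rewrite -ltnS -hd ltn_modp.
  apply/eqP; rewrite -subr_eq0 -rmorphB; apply/eqP/ha.
  by rewrite {1}(divp_eq g h) addrK dvdp_mulIr.
move=> c; rewrite -aE => /eqP; rewrite -subr_eq0 -rmorphB => /eqP/ha dvd.
apply: (can_inj (@rVpolyK _ _)).
rewrite poly_rV_K; last by rewrite -ltnS -hd ltn_modp.
rewrite -[rVpoly c](@modp_small _ _ h); last first.
  by rewrite hd ltnS size_poly.
by apply/eqP; rewrite -subr_eq0 -modpN -modpD; apply: dvd.
Qed.

End QuotientPolynomial.

(** * Presentation and universal property of the Artin-Schreier algebra *)

Section UniversalProperty.
Variables (K : fieldType) (p : nat) (pcharK : p \in [pchar K]).
Variables (n : nat) (f : 'I_n -> K).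
Local Notation A := (AS_alg pcharK f).
Local Notation wgen := (AS_gen pcharK f).
Local Notation rep a :=
  (generic_quotient.repr (a : {ideal_quot (AS_ideal pcharK f)})).

Lemma AS_pchar : p \in [pchar A].
Proof. by rewrite pchar_lalg. Qed.

Lemma AS_pi_surj (a : A) : exists g, a = AS_pi pcharK f g.
Proof. by exists (rep a); rewrite /AS_pi reprK. Qed.

Lemma AS_pi_scale (k : K) g : AS_pi pcharK f (k *: g) = k *: AS_pi pcharK f g.
Proof. by rewrite -mul_mpolyC [LHS]rmorphM. Qed.

Lemma AS_piX (m : 'X_{1..n}) : AS_pi pcharK f 'X_[m] = \prod_i wgen i ^+ m i.
Proof.
rewrite mpolyXE_id [LHS]rmorph_prod; apply: eq_bigr => i _.
by rewrite rmorphXn.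
Qed.

Lemma AS_genP k : wgen k ^+ p - wgen k = (f k)%:A.
Proof.
suff : AS_pi pcharK f (AS_rel p f k) = 0.
  rewrite /AS_rel /AS_pi !rmorphB rmorphXn -/(AS_pi _ _ _) => /eqP.
  by rewrite subr_eq0 => /eqP ->; rewrite [RHS]mulr1.
rewrite -[0](rmorph0 (\pi_({ideal_quot (AS_ideal pcharK f)}))%qT).
apply/eqP; rewrite /AS_pi -Quotient.idealrBE subr0; apply/asboolP.
exists (fun j => (j == k)%:R); rewrite (bigD1 k) //= big1 => [|j /negPf ->].
  by rewrite eqxx mul1r addr0.
by rewrite mul0r.
Qed.

Lemma AS_genE k : wgen k ^+ p = wgen k + (f k)%:A.
Proof. by rewrite -AS_genP addrC subrK. Qed.

Lemma AS_ext (B : comAlgType K) (phi psi : {lrmorphism A -> B}) :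
  (forall k, phi (wgen k) = psi (wgen k)) -> phi =1 psi.
Proof.
move=> eq_gen a; have [g ->] := AS_pi_surj a.
elim/mpolyind: g => [|c m g _ _ IH]; first by rewrite /AS_pi !rmorph0.
rewrite [AS_pi _ _ _]rmorphD !rmorphD /= -/(AS_pi _ _ _) -/(AS_pi _ _ g) IH.
congr (_ + _); rewrite AS_pi_scale !linearZ /=; congr (_ *: _).
rewrite AS_piX !rmorph_prod /=.
by apply: eq_bigr => i _; rewrite !rmorphXn /= eq_gen.
Qed.

Lemma AS_sub_gen (V : A -> Prop) : is_subalg V -> (forall k, V (wgen k)) ->
  forall a, V a.
Proof.
case=> V1 VL VM Vgen a; have [g ->] := AS_pi_surj a.
have VX b m : V b -> V (b ^+ m).
  by move=> Vb; elim: m => // m IH; rewrite exprS; apply: VM.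
have V0 : V 0 by rewrite -(subrr 1) -scaleN1r addrC; apply: VL.
elim/mpolyind: g => [|c m g _ _ IH]; first by rewrite /AS_pi rmorph0.
rewrite [AS_pi _ _ _]rmorphD /= -/(AS_pi _ _ _) -/(AS_pi _ _ g) AS_pi_scale.
apply: VL => //; rewrite AS_piX.
by apply: (big_ind V) => // i _; apply: VX.
Qed.

Lemma AS_univ (B : comAlgType K) (b : 'I_n -> B) :
  (forall k, b k ^+ p - b k = (f k)%:A) ->
  exists phi : {lrmorphism A -> B}, forall k, phi (wgen k) = b k.
Proof.
move=> bP; pose ev : {mpoly K[n]} -> B := mmap (GRing.in_alg B) b.
have evZ k g : ev (k *: g) = k *: ev g.
  by rewrite /ev mmapZ mulr_algl.
have evD g h : ev (g + h) = ev g + ev h by exact: rmorphD.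
have evM g h : ev (g * h) = ev g * ev h by exact: rmorphM.
(* The representative differs from [g] by an element of the ideal, which [ev] kills. *)
have evP g : ev (rep (AS_pi pcharK f g)) = ev g.
  apply/eqP; rewrite -subr_eq0 -rmorphB.
  have : rep (AS_pi pcharK f g) - g \in AS_ideal pcharK f.
    by rewrite Quotient.idealrBE reprK.
  case/asboolP=> h ->; rewrite rmorph_sum big1 //= => k _.
  rewrite rmorphM !rmorphB rmorphXn /= mmapX mmap1U mmapC bP.
  by rewrite subrr mulr0.
have [||phi phiE] := @lrmorphism_of K A B (fun a => ev (rep a)).
- move=> k x y; have [g ->] := AS_pi_surj x; have [h ->] := AS_pi_surj y.
  rewrite -AS_pi_scale.
  rewrite -[_ + _](rmorphD (\pi_({ideal_quot (AS_ideal pcharK f)}))%qT).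
  by rewrite -/(AS_pi _ _ _) !evP evD evZ.
- split=> [|x y].
    by rewrite -[1](rmorph1 (\pi_({ideal_quot (AS_ideal pcharK f)}))%qT)
       -/(AS_pi _ _ _) evP /ev rmorph1.
  have [g ->] := AS_pi_surj x; have [h ->] := AS_pi_surj y.
  rewrite -[_ * _](rmorphM (\pi_({ideal_quot (AS_ideal pcharK f)}))%qT).
  by rewrite -/(AS_pi _ _ _) !evP evM.
by exists phi => k; rewrite phiE evP /ev /= mmapX mmap1U.
Qed.

End UniversalProperty.

(** * The primitive element [w] *)

Section MatrixAction.
Variables (K : fieldType) (V : lmodType K) (m : nat).

(** Matrices over [K] acting on families of vectors, so that an invertible Moore matrix can solve a
    system with unknowns in a [K]-algebra. *)
Definition mxact (M : 'M[K]_m) (v : 'I_m -> V) (i : 'I_m) : V :=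
  \sum_j M i j *: v j.

Lemma mxactM M N v : mxact (M *m N) v =1 mxact M (mxact N v).
Proof.
move=> i; rewrite /mxact; under [RHS]eq_bigr do rewrite scaler_sumr.
rewrite exchange_big; apply: eq_bigr => j _; rewrite mxE scaler_suml.
by apply: eq_bigr => k _; rewrite scalerA.
Qed.

Lemma mxact1 v : mxact 1%:M v =1 v.
Proof.
move=> i; rewrite /mxact (bigD1 i) //= big1 => [|j ne_j].
  by rewrite mxE eqxx scale1r addr0.
by rewrite mxE eq_sym (negPf ne_j) scale0r.
Qed.

Lemma eq_mxact M (u v : 'I_m -> V) : u =1 v -> mxact M u =1 mxact M v.
Proof. by move=> uv i; apply: eq_bigr => j _; rewrite uv. Qed.

Lemma mxactK M v : M \in unitmx -> mxact (invmx M) (mxact M v) =1 v.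
Proof. by move=> uM i; rewrite -mxactM mulVmx ?mxact1. Qed.

Lemma mxactVK M v : M \in unitmx -> mxact M (mxact (invmx M) v) =1 v.
Proof. by move=> uM i; rewrite -mxactM mulmxV ?mxact1. Qed.

End MatrixAction.

Lemma horner_alg_addpoly (K : fieldType) (p n : nat) (l : nat -> K)
    (B : comAlgType K) (x : B) :
  horner_alg x (addpoly p n l) = \sum_(m < n.+1) l m *: x ^+ (p ^ m).
Proof.
rewrite rmorph_sum; apply: eq_bigr => m _ /=.
by rewrite horner_algZ rmorphXn /= horner_algX.
Qed.

Section PrimitiveElement.
Variables (K : fieldType) (p : nat) (pcharK : p \in [pchar K]).
Variables (n : nat) (f : 'I_n.+1 -> K).
Let p_pr := pcharf_prime pcharK.
Local Notation D := (moore p f).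
Local Notation H := (cohat p f).
Local Notation A := (AS_alg pcharK f).
Local Notation w := (AS_w pcharK f).
Local Notation wgen := (AS_gen pcharK f).
Hypothesis D_neq0 : D != 0.

Lemma AS_wE : w = \sum_j H j *: wgen j.
Proof.
rewrite /AS_w (expand_det_row _ ord0); apply: eq_bigr => j _.
rewrite mxE /= /cofactor /cohat -scalerA mulrC.
transitivity ((-1) ^+ (0 + j) * (hat_moore p f j)%:A * wgen j).
  congr (_ * _ * _); rewrite -[_%:A]/(GRing.in_alg A _) -det_map_mx.
  by congr (\det _); apply/matrixP=> a b; rewrite !mxE.
rewrite -mulrA mulr_algl -[RHS]mulr_algl; congr (_ * _).
by rewrite -[RHS]/(GRing.in_alg A _) rmorph_sign.
Qed.

Lemma moore_cohat_neq0 : moore p H != 0.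
Proof.
have h_neq0 : moore p (hat_moore p f) != 0.
  by have [c_top c_f] := span_coefP pcharK D_neq0; apply: moore_hat_neq0 c_f _.
have -> : moore p H =
    \det (\matrix_(i < n.+1, j < n.+1) hat_moore p f j ^+ (p ^ i)
          *m diag_mx (\row_j (-1) ^+ nat_of_ord j)).
  congr (\det _); rewrite mul_mx_diag; apply/matrixP=> i j.
  by rewrite !mxE cohat_exp // mulrC.
rewrite det_mulmx mulf_neq0 // det_diag; apply/prodf_neq0 => j _.
by rewrite mxE signr_eq0.
Qed.

Lemma AS_QP : exists l : nat -> K,
  [/\ l n.+1 = 1, AS_Q p f = addpoly p n.+1 l - (D ^+ (p ^ n))%:P
    & forall j, \sum_(m < n.+2) l m * H j ^+ (p ^ m) = 0].
Proof.
have h_neq0 : moore p (hat_moore p f) != 0.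
  by have [c_top c_f] := span_coefP pcharK D_neq0; apply: moore_hat_neq0 c_f _.
have [l [ln QE lh]] := moore_polyE h_neq0; exists l; split=> //.
  by rewrite /AS_Q QE.
move=> j; rewrite -[RHS](mulr0 ((-1) ^+ j)) -[X in _ * X](lh j) mulr_sumr.
by apply: eq_bigr => m _; rewrite cohat_exp // mulrCA.
Qed.

Lemma size_AS_Q : size (AS_Q p f) = (p ^ n.+1).+1.
Proof.
have [l [ln -> _]] := AS_QP; rewrite size_polyDl size_addpoly //.
by rewrite size_polyN (leq_ltn_trans (size_polyC_leq1 _)) // ltnS expn_gt0 prime_gt0.
Qed.

Lemma monic_AS_Q : AS_Q p f \is monic.
Proof.
have [l [ln -> _]] := AS_QP; rewrite monicE lead_coefDl.
  exact: monic_addpoly.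
rewrite size_addpoly // size_polyN (leq_ltn_trans (size_polyC_leq1 _)) //.
by rewrite ltnS expn_gt0 prime_gt0.
Qed.

(** The scalar part of [w ^+ (p ^ k)], produced by adding [f j ^+ (p ^ i)] to the generator [j] for
    each [i < k]; see [xexp]. *)
Definition beta (k : nat) : K := \sum_(i < k) pairing p f k i.

Lemma beta_sum l : l n.+1 = 1 ->
  (forall j, \sum_(m < n.+2) l m * H j ^+ (p ^ m) = 0) ->
  \sum_(k < n.+2) l k * beta k = D ^+ (p ^ n).
Proof.
move=> ln lH.
have l_pair i : \sum_(k < n.+2) l k * pairing p f k i = 0.
  under eq_bigr do rewrite mulr_sumr.
  rewrite exchange_big big1 //= => j _.
  under eq_bigr do rewrite mulrA.
  by rewrite -mulr_suml lH mul0r.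
transitivity (\sum_(i < n.+1) \sum_(k < n.+2 | (i < k)%N) l k * pairing p f k i).
  rewrite (exchange_big_dep xpredT) //=; apply: eq_bigr => k _.
  by rewrite -mulr_sumr /beta (big_ord_widen n.+1) // -ltnS.
rewrite big_ord_recr /= big1 ?add0r => [|i _].
  rewrite (bigD1 ord_max) //= ln mul1r pairing_low // big1 ?addr0 //.
  by move=> k; rewrite -val_eqE /=; have := ltn_ord k; lia.
apply/eqP; rewrite -[X in X == _]addr0 -[X in _ + X](_ :
  \sum_(k < n.+2 | ~~ (i < k)%N) l k * pairing p f k i = 0).
  by rewrite -(bigID (fun k : 'I_n.+2 => (i < k)%N) xpredT) /= l_pair.
rewrite big1 // => k le_k; rewrite pairing_eq0 ?mulr0 //.
by have := ltn_ord i; lia.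
Qed.

Lemma beta_frob k : beta k ^+ p + pairing p f k.+1 0 = beta k.+1.
Proof.
rewrite /beta big_ord_recl /= addrC; congr (_ + _).
rewrite -[X in _ ^+ X]expn1 exprp_sum //; apply: eq_bigr => i _.
by rewrite pairing_exp // !addn1.
Qed.

Let Hmx := \matrix_(k < n.+1, j < n.+1) H j ^+ (p ^ k).
Let Hmx' := \matrix_(k < n.+1, j < n.+1) H j ^+ (p ^ k.+1).

Let Hmx_unit : Hmx \in unitmx.
Proof. by rewrite unitmxE unitfE; apply: moore_cohat_neq0. Qed.

Let Hmx'_unit : Hmx' \in unitmx.
Proof.
have -> : Hmx' = \matrix_(i, j) Hmx i j ^+ (p ^ 1).
  by apply/matrixP=> i j; rewrite !mxE -exprM -expnD addn1.
by rewrite unitmxE unitfE -exprp_det // expf_neq0 // moore_cohat_neq0.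
Qed.

(* [wgen j] as a polynomial in [w], obtained by solving the Moore system. *)
Definition gpoly (j : 'I_n.+1) : {poly K} :=
  mxact (invmx Hmx) (fun k : 'I_n.+1 => 'X^(p ^ k) - (beta k)%:P) j.

Let horner_gpoly (B : comAlgType K) (x : B) j :
  horner_alg x (gpoly j) =
  mxact (invmx Hmx) (fun k : 'I_n.+1 => x ^+ (p ^ k) - (beta k)%:A) j.
Proof.
rewrite rmorph_sum; apply: eq_bigr => k _ /=.
by rewrite horner_algZ rmorphB /= horner_algC rmorphXn /= horner_algX.
Qed.

Section Solutions.
Variables (B : comAlgType K).
Let pcharB : p \in [pchar B]. Proof. by rewrite pchar_lalg. Qed.

Section FromGenerators.
Variable y : 'I_n.+1 -> B.
Hypothesis yP : forall j, y j ^+ p - y j = (f j)%:A.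
Let x := \sum_j H j *: y j.

Let yexp j k : y j ^+ (p ^ k) = y j + (\sum_(i < k) f j ^+ (p ^ i))%:A.
Proof.
elim: k => [|k IHk]; first by rewrite big_ord0 scale0r addr0.
have yE : y j ^+ p = y j + (f j)%:A by rewrite -yP addrC subrK.
rewrite expnSr exprM IHk -[X in _ ^+ X]expn1 exprpD // expn1 yE -addrA.
congr (_ + _); rewrite big_ord_recl /= expr1 scalerDl; congr (_ + _).
rewrite exprZn expr1n -[X in _ ^+ X]expn1 exprp_sum //; congr (_ *: 1).
by apply: eq_bigr => i _; rewrite -exprM -expnD addn1.
Qed.

Lemma xexp k : x ^+ (p ^ k) = \sum_j H j ^+ (p ^ k) *: y j + (beta k)%:A.
Proof.
rewrite exprp_sum //; under eq_bigr do rewrite exprZn yexp scalerDr scalerA.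
rewrite big_split /=; congr (_ + _); rewrite -scaler_suml; congr (_ *: 1).
under eq_bigr do rewrite mulr_sumr.
by rewrite exchange_big.
Qed.

(** Combining the equations [xexp] with the coefficients [l] removes the [y j], and the scalar parts
    add up to [beta_sum]. *)
Lemma horner_AS_Q_gen : horner_alg x (AS_Q p f) = 0.
Proof.
have [l [ln -> lH]] := AS_QP.
rewrite rmorphB /= horner_algC horner_alg_addpoly.
under eq_bigr do rewrite xexp scalerDr scalerA.
rewrite big_split /= -scaler_suml beta_sum // addrK.
under eq_bigr do rewrite scaler_sumr.
rewrite exchange_big big1 //= => j _.
by under eq_bigr do rewrite scalerA; rewrite -scaler_suml lH scale0r.
Qed.

Lemma horner_gpoly_gen j : horner_alg x (gpoly j) = y j.
Proof.
rewrite horner_gpoly -[RHS](mxactK y Hmx_unit); apply: eq_mxact => k.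
by rewrite xexp addrK; apply: eq_bigr => i _; rewrite mxE.
Qed.

End FromGenerators.

Section FromRoot.
Variable x : B.
Hypothesis Qx : horner_alg x (AS_Q p f) = 0.
Let y j := horner_alg x (gpoly j).

(** For [k <= n] this is the linear system that defines [gpoly]. The remaining equation [k = n.+1]
    is where [Qx] enters: in the combination of all equations with coefficients [l], it is the only
    term not already known to vanish. *)
Let ysys k : (k <= n.+1)%N ->
  \sum_j H j ^+ (p ^ k) *: y j = x ^+ (p ^ k) - (beta k)%:A.
Proof.
have ysys_lt (i : 'I_n.+1) :
    \sum_j H j ^+ (p ^ i) *: y j = x ^+ (p ^ i) - (beta i)%:A.
  rewrite -(mxactVK (fun k : 'I_n.+1 => x ^+ (p ^ k) - (beta k)%:A) Hmx_unit).
  by apply: eq_bigr => j _; rewrite -horner_gpoly mxE.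
rewrite leq_eqVlt => /predU1P[->{k}|lt_k]; last exact: (ysys_lt (Ordinal lt_k)).
have [l [ln QE lH]] := AS_QP.
have : \sum_(k < n.+2) l k *: (\sum_j H j ^+ (p ^ k) *: y j
          - (x ^+ (p ^ k) - (beta k)%:A)) = 0.
  under eq_bigr do rewrite opprB addrCA -opprB scalerBr scalerA.
  move: Qx; rewrite QE rmorphB /= horner_algC horner_alg_addpoly => /subr0_eq.
  under eq_bigr do rewrite scalerBr.
  rewrite sumrB -scaler_suml beta_sum // sumrB => ->.
  rewrite opprB addrC subrK.
  under eq_bigr do rewrite scaler_sumr.
  rewrite exchange_big big1 //= => j _.
  by under eq_bigr do rewrite scalerA; rewrite -scaler_suml lH scale0r.
rewrite big_ord_recr /= big1 ?add0r => [|i _]; last first.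
  by rewrite ysys_lt subrr scaler0.
by rewrite ln scale1r => /subr0_eq.
Qed.

Lemma gpoly_root_gen : x = \sum_j H j *: y j.
Proof.
have := @ysys 0 isT; rewrite /beta big_ord0 scale0r subr0 expn0 expr1 => <-.
by apply: eq_bigr => j _; rewrite expr1.
Qed.

(** Let [d] be the vector of defects. Comparing the Frobenius image of equation [k] of [ysys] with
    equation [k.+1], whose scalars match by [beta_frob], shows that the invertible matrix [Hmx']
    kills [d]. *)
Lemma gpoly_root_AS j : y j ^+ p - y j = (f j)%:A.
Proof.
apply/eqP; rewrite -subr_eq0; apply/eqP; move: j.
pose d j := y j ^+ p - y j - (f j)%:A; rewrite -/(d _).
suff d0 : mxact Hmx' d =1 fun=> 0.
  move=> j; rewrite -[LHS]/(d j) -(mxactK d Hmx'_unit).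
  by rewrite (eq_mxact _ d0) /mxact big1 // => i _; rewrite scaler0.
move=> k; rewrite /mxact.
have := congr1 (fun b => b ^+ (p ^ 1)) (@ysys k (ltnW (ltn_ord k))).
rewrite exprp_sum // exprpB // exprZn expr1n -exprM -expnD addn1 expn1.
move=> yk; have := beta_frob k; move/(congr1 (fun c : K => c%:A : B)).
rewrite scalerDl => bk; have := @ysys k.+1 (ltn_ord k); rewrite -bk => yk1.
transitivity (\sum_j (H j ^+ (p ^ k) *: y j) ^+ p
   - \sum_j H j ^+ (p ^ k.+1) *: y j - (pairing p f k.+1 0)%:A).
  rewrite /pairing scaler_suml -!sumrB; apply: eq_bigr => j _.
  by rewrite mxE exprZn -exprM -expnSr !scalerBr scalerA expr1.
have cancel_all (X b q : B) : X - b - (X - (b + q)) - q = 0.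
  apply/eqP; rewrite subr_eq0 subr_eq opprD addrCA [q + (- b - q)]addrCA.
  by rewrite subrr addr0.
by rewrite yk yk1 cancel_all.
Qed.

End FromRoot.
End Solutions.

(** For the direct implication, the [gpoly] at the class of [W] modulo [AS_Q] satisfy the defining
    equations, so the universal property gives a morphism sending [w] to that class; a polynomial
    vanishing at [w] then vanishes in the quotient. *)
Lemma horner_AS_w g : horner_alg w g = 0 <-> AS_Q p f %| g.
Proof.
have Q_gt1 : (1 < size (AS_Q p f))%N.
  by rewrite size_AS_Q ltnS expn_gt0 prime_gt0.
split=> [wg|/dvdpP[h ->]]; last first.
  rewrite rmorphM /= AS_wE horner_AS_Q_gen ?mulr0 // => j; exact: AS_genP.
have Qq : horner_alg ('qX : {poly %/ AS_Q p f}) (AS_Q p f) = 0.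
  by apply/horner_qX_eq0; rewrite ?monic_AS_Q.
have [psi psiE] := AS_univ pcharK (gpoly_root_AS Qq).
apply/(horner_qX_eq0 monic_AS_Q Q_gt1).
have <- : psi w = 'qX.
  rewrite AS_wE linear_sum [RHS](gpoly_root_gen Qq); apply: eq_bigr => j _.
  by rewrite linearZ /= psiE.
by rewrite -lrmorph_horner wg rmorph0.
Qed.

Lemma gen_AS_w (a : A) : gen_alg w a.
Proof.
apply: AS_sub_gen a; first exact: gen_alg_subalg.
move=> j; exists (gpoly j); rewrite AS_wE horner_gpoly_gen // => k.
exact: AS_genP.
Qed.

Lemma quot_iso_AS_w : quot_iso (AS_Q p f) (fun _ : A => True) w.
Proof.
have [|phi [phi_inj phiP phi_w]] := quot_isoP monic_AS_Q _ horner_AS_w.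
  by rewrite size_AS_Q ltnS expn_gt0 prime_gt0.
exists phi; split=> // b; split=> // _; apply/phiP/gen_AS_w.
Qed.

End PrimitiveElement.

(** * The group of shifts and its invariants *)

Lemma poly_const_values (R : idomainType) (g : {poly R}) (rs : seq R) k :
  uniq rs -> (0 < size rs)%N -> (size g <= size rs)%N ->
  (forall z, z \in rs -> g.[z] = k) -> g = k%:P.
Proof.
move=> urs rs_gt0 le_g gk; apply/eqP; rewrite -subr_eq0; apply: contraT => nz.
have : (size rs < size (g - k%:P)%R)%N.
  apply: max_poly_roots => //; apply/allP => z /gk gz.
  by rewrite rootE !hornerE gz subrr.
rewrite ltnNge (leq_trans (size_polyD _ _)) // geq_max le_g size_polyN.
by rewrite (leq_trans (size_polyC_leq1 _)).
Qed.

(** A translation keeps the degree and the leading coefficient. The drop drives the descent in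
    [AS_comb_size] and the divisibility argument in [AS_fixed]. *)
Lemma size_shift_sub (R : idomainType) (g : {poly R}) z : g != 0 ->
  (size (g \Po ('X + z%:P) - g)%R < size g)%N.
Proof.
move=> g_neq0; have s2 : size ('X + z%:P) = 2%N by rewrite size_XaddC.
have sg : size (g \Po ('X + z%:P)) = size g by rewrite size_comp_poly2.
rewrite -(prednK (n := size g)) ?size_poly_gt0 // ltnS; apply/leq_sizeP => j.
rewrite leq_eqVlt => /predU1P[<-|lt_j].
  rewrite coefB -{1}sg -!lead_coefE lead_coef_comp ?s2 //.
  by rewrite lead_coefXaddC expr1n mulr1 subrr.
have le_j : (size g <= j)%N by move: lt_j; case: (size g).
by rewrite coefB !nth_default ?subrr ?sg.
Qed.

Section DotProduct.
Variables (p n : nat).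
Implicit Types a b e : 'rV['F_p]_n.

Lemma dotvDl a b e : dotv (a + b) e = dotv a e + dotv b e.
Proof. by rewrite -big_split; apply: eq_bigr => i _; rewrite mxE mulrDl. Qed.

Lemma dotvZl c a e : dotv (c *: a) e = c * dotv a e.
Proof. by rewrite mulr_sumr; apply: eq_bigr => i _; rewrite mxE mulrA. Qed.

Lemma dotv_delta i e : dotv (delta_mx 0 i) e = e 0 i.
Proof.
rewrite /dotv (bigD1 i) //= mxE !eqxx mul1r big1 ?addr0 // => j ne_j.
by rewrite mxE (negPf ne_j) andbF mul0r.
Qed.

Lemma dotv_surj e c : e != 0 -> exists a, dotv a e = c.
Proof.
case/rV0Pn=> i ei; exists ((c / e 0 i) *: delta_mx 0 i).
by rewrite dotvZl dotv_delta divfK.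
Qed.

Lemma dotv_proportional e e' : e != 0 ->
  (forall a, dotv a e = 0 -> dotv a e' = 0) -> exists c, e' = c *: e.
Proof.
case/rV0Pn=> k ek ker; exists (e' 0 k / e 0 k); apply/rowP=> j; rewrite mxE.
(* This test vector is orthogonal to [e] by construction. *)
have := ker (delta_mx 0 j + (- (e 0 j / e 0 k)) *: delta_mx 0 k).
rewrite !dotvDl !dotvZl !dotv_delta mulNr divfK // subrr => /(_ erefl)/eqP.
by rewrite addr_eq0 mulNr opprK => /eqP ->; rewrite mulrAC [e 0 j * _]mulrC mulrAC.
Qed.

End DotProduct.

Section Shifts.
Variables (K : fieldType) (p : nat) (pcharK : p \in [pchar K]).
Variables (n : nat) (f : 'I_n -> K).
Let p_pr := pcharf_prime pcharK.
Local Notation A := (AS_alg pcharK f).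
Local Notation wgen := (AS_gen pcharK f).
Local Notation pcharA := (AS_pchar pcharK f).

Lemma FprA x : Fpr pcharA x = (Fpr pcharK x)%:A.
Proof. by rewrite /Fpr -[RHS]/(GRing.in_alg A _) rmorph_nat. Qed.

Lemma AS_shift_ex (a : 'rV['F_p]_n) :
  exists s : {lrmorphism A -> A},
    forall k, s (wgen k) = wgen k + Fpr pcharA (a 0 k).
Proof.
apply: AS_univ => k; rewrite -[X in _ ^+ X]expn1 exprpD ?AS_pchar // expn1.
by rewrite Fpr_frob opprD addrACA subrr addr0 AS_genP.
Qed.

Definition AS_shift a : {lrmorphism A -> A} := projT1 (cid (AS_shift_ex a)).

Lemma AS_shiftE a k : AS_shift a (wgen k) = wgen k + Fpr pcharA (a 0 k).
Proof. exact: (projT2 (cid (AS_shift_ex a))). Qed.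

Lemma AS_shift0 : AS_shift 0 =1 id.
Proof.
apply: (AS_ext (psi := idfun)) => k.
by rewrite AS_shiftE mxE rmorph0 addr0.
Qed.

Lemma AS_shiftD a b : AS_shift (a + b) =1 AS_shift a \o AS_shift b.
Proof.
apply: (AS_ext (psi := AS_shift a \o AS_shift b)) => k.
rewrite /= !AS_shiftE rmorphD /= AS_shiftE mxE rmorphD -addrA; congr (_ + (_ + _)).
by rewrite /Fpr rmorph_nat.
Qed.

Lemma AS_shift_inj a b : AS_shift a =1 AS_shift b -> a = b.
Proof.
move=> ab; apply/rowP=> k; apply: (fmorph_inj (Fpr pcharA)).
by have := ab (wgen k); rewrite !AS_shiftE => /addrI.
Qed.

Lemma AS_shift_bij a : bijective (AS_shift a).
Proof.
exists (AS_shift (- a)) => x.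
  by rewrite -[LHS]/((AS_shift (- a) \o AS_shift a) x) -AS_shiftD addNr AS_shift0.
by rewrite -[LHS]/((AS_shift a \o AS_shift (- a)) x) -AS_shiftD subrr AS_shift0.
Qed.

Lemma AS_shift_comb a (eps : 'rV['F_p]_n) :
  AS_shift a (Fp_comb eps wgen) = Fp_comb eps wgen + Fpr pcharA (dotv a eps).
Proof.
rewrite (additive_Fp_comb _ _ (rmorphD (AS_shift a))) !(Fp_combE pcharA).
rewrite rmorph_sum -big_split; apply: eq_bigr => k _ /=.
by rewrite AS_shiftE mulrDr rmorphM [X in _ + X = _]mulrC.
Qed.

Lemma AS_comb_AS (eps : 'rV['F_p]_n) :
  Fp_comb eps wgen ^+ p - Fp_comb eps wgen = (Fp_comb eps f)%:A.
Proof.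
have := exprp_Fp_comb 1 eps wgen pcharA; rewrite expn1 => ->; rewrite -sumrB.
rewrite scaler_suml; apply: eq_bigr => k _.
by rewrite -mulrnBl AS_genP scalerMnl.
Qed.

(** Descent on the degree. A shift with [dotv a eps = 1] moves the element by 1, so the difference
    of [g] and its translate by 1 also annihilates it. If [size g <= p], this difference is zero by
    induction; then [g] is constant on the prime field, hence constant, and a nonzero constant
    annihilates nothing. *)
Lemma AS_comb_size (eps : 'rV['F_p]_n) g : eps != 0 -> g != 0 ->
  horner_alg (Fp_comb eps wgen) g = 0 -> (p < size g)%N.
Proof.
move=> eps_neq0; have [a a1] := dotv_surj 1 eps_neq0.
elim: {g}(size g) {-2}g (leqnn (size g)) => [|m IH] g.
  by rewrite leqn0 size_poly_eq0 => /eqP ->; rewrite eqxx.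
move=> le_g g_neq0 g0; rewrite ltnNge; apply/negP => le_gp.
have := size_shift_sub 1 g_neq0; set g' := _ - g => lt_g'.
have g'0 : horner_alg (Fp_comb eps wgen) g' = 0.
  rewrite rmorphB /= g0 subr0 horner_alg_comp rmorphD /= horner_algX horner_algC.
  have := AS_shift_comb a eps; rewrite a1 rmorph1 scale1r => <-.
  by rewrite -lrmorph_horner g0 rmorph0.
have {lt_g' g'0 IH} : g' = 0.
  apply/eqP; apply: contraT => nz.
  have := IH g' _ nz g'0; rewrite -ltnS => /(_ (leq_trans lt_g' le_g)).
  by rewrite ltnNge (leq_trans (ltnW lt_g')).
move/subr0_eq => gE.
have gc c : g.[c%:R] = g.[0].
  by elim: c => // c <-; rewrite -{2}gE horner_comp !hornerE -natr1.
have : g = (g.[0])%:P.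
  apply: (@poly_const_values _ _ [seq Fpr pcharK x | x : 'F_p]).
  - by rewrite map_inj_uniq ?enum_uniq //; apply: fmorph_inj.
  - by rewrite size_map -cardE card_Fp ?prime_gt0.
  - by rewrite size_map -cardE card_Fp.
  by move=> _ /mapP[x _ ->]; apply: gc.
move=> gC; move: g0 g_neq0; rewrite gC horner_algC polyC_eq0 => /eqP.
by rewrite -[_%:A]/(GRing.in_alg A _) fmorph_eq0 => ->.
Qed.

Definition AS_poly (eps : 'rV['F_p]_n) : {poly K} :=
  'X^p - 'X - (Fp_comb eps f)%:P.

Let size_sub (eps : 'rV['F_p]_n) :
  (size ('X + (Fp_comb eps f)%:P)%R < size ('X^p : {poly K}))%N.
Proof. by rewrite size_XaddC size_polyXn ltnS prime_gt1. Qed.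

Lemma size_AS_poly eps : size (AS_poly eps) = p.+1.
Proof.
by rewrite /AS_poly -addrA -opprD size_polyDl ?size_polyN // size_polyXn.
Qed.

Lemma monic_AS_poly eps : AS_poly eps \is monic.
Proof.
by rewrite monicE /AS_poly -addrA -opprD lead_coefDl ?size_polyN // lead_coefXn.
Qed.

Lemma horner_AS_comb (eps : 'rV['F_p]_n) g : eps != 0 ->
  horner_alg (Fp_comb eps wgen) g = 0 <-> AS_poly eps %| g.
Proof.
move=> eps_neq0; set x := Fp_comb _ _.
have xP : horner_alg x (AS_poly eps) = 0.
  rewrite /AS_poly !rmorphB rmorphXn /= horner_algX horner_algC.
  by rewrite AS_comb_AS subrr.
split=> [g0|/dvdpP[h ->]]; last by rewrite rmorphM /= xP mulr0.
apply: contraT => ndvd; have : (size (g %% AS_poly eps)%R < p.+1)%N.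
  by rewrite -(size_AS_poly eps) ltn_modp monic_neq0 ?monic_AS_poly.
rewrite ltnS leqNgt (AS_comb_size eps_neq0) //.
by rewrite -[g %% _](addrK (g %/ AS_poly eps * AS_poly eps)) [_ + _ * _]addrC
  -divp_eq rmorphB rmorphM /= xP mulr0 g0 subr0.
Qed.

Lemma AS_comb_properties (eps : 'rV['F_p]_n) : eps != 0 ->
  [/\ Fp_comb eps wgen ^+ p - Fp_comb eps wgen = (Fp_comb eps f)%:A,
      quot_iso (AS_poly eps) (gen_alg (Fp_comb eps wgen)) (Fp_comb eps wgen),
      is_subalg (gen_alg (Fp_comb eps wgen))
    & has_Kdim (gen_alg (Fp_comb eps wgen)) p].
Proof.
move=> eps_neq0; have kerE g := horner_AS_comb g eps_neq0.
split.
- exact: AS_comb_AS.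
- by apply: quot_isoP; rewrite ?monic_AS_poly ?size_AS_poly ?ltnS ?prime_gt0.
- exact: gen_alg_subalg.
- by apply: (has_Kdim_gen (monic_AS_poly eps)); rewrite ?size_AS_poly.
Qed.

End Shifts.

Section ShiftsOfW.
Variables (K : fieldType) (p : nat) (pcharK : p \in [pchar K]).
Variables (n : nat) (f : 'I_n.+1 -> K).
Let p_pr := pcharf_prime pcharK.
Local Notation H := (cohat p f).
Local Notation A := (AS_alg pcharK f).
Local Notation w := (AS_w pcharK f).
Local Notation sh := (AS_shift pcharK f).
Hypothesis D_neq0 : moore p f != 0.

Lemma AS_shift_w a : sh a w = w + (Fp_comb a H)%:A.
Proof.
rewrite !AS_wE linear_sum (Fp_combE pcharK) scaler_suml -big_split.
apply: eq_bigr => j _ /=.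
by rewrite linearZ /= AS_shiftE scalerDr FprA scalerA mulrC.
Qed.

Lemma AS_shift_horner a g :
  sh a (horner_alg w g) = horner_alg w (g \Po ('X + (Fp_comb a H)%:P)).
Proof.
rewrite lrmorph_horner AS_shift_w horner_alg_comp rmorphD /=.
by rewrite horner_algX horner_algC.
Qed.

(** Write [x] as a polynomial [g] in [w], reduced modulo [AS_Q]. Invariance makes [AS_Q] divide the
    difference of [g] and each of its translates by the span of [H]; by degree these differences are
    zero. So [g] takes one value at [p ^ n.+1] points and is constant. *)
Lemma AS_fixed (x : A) : (forall a, sh a x = x) -> exists k, x = k%:A.
Proof.
have [g0 ->{x}] := gen_AS_w D_neq0 x; move=> fix_x.
have Q_neq0 : AS_Q p f != 0 by rewrite monic_neq0 ?monic_AS_Q.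
pose g := g0 %% AS_Q p f.
have gE : horner_alg w g0 = horner_alg w g.
  apply/eqP; rewrite -subr_eq0 -rmorphB; apply/eqP/horner_AS_w => //.
  by rewrite {1}(divp_eq g0 (AS_Q p f)) addrK dvdp_mulIr.
have lt_g : (size g <= p ^ n.+1)%N.
  by rewrite -ltnS -(size_AS_Q pcharK D_neq0) ltn_modp.
rewrite gE in fix_x *; exists g.[0].
suff -> : g = (g.[0])%:P by rewrite hornerC horner_algC.
have spanE : size (Fp_span p H) = (p ^ n.+1)%N.
  by apply: size_Fp_span => //; apply: (moore_neq0_inj pcharK); apply: moore_cohat_neq0.
apply: (@poly_const_values _ _ (Fp_span p H)).
- exact: undup_uniq.
- by rewrite spanE expn_gt0 prime_gt0.
- by rewrite spanE.
move=> _ /Fp_spanP[a ->]; have := fix_x a; rewrite AS_shift_horner => /eqP.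
have [->|g_neq0] := eqVneq g 0; first by rewrite !horner0.
rewrite -subr_eq0 -rmorphB => /eqP/(horner_AS_w pcharK D_neq0).
have := size_shift_sub (Fp_comb a H) g_neq0; set d := _ - g => lt_d dvd.
have [/subr0_eq d0|d_neq0] := eqVneq d 0.
  by rewrite -{2}d0 horner_comp !hornerE.
by have := dvdp_leq d_neq0 dvd; rewrite size_AS_Q // leqNgt (ltn_trans lt_d) // ltnS.
Qed.

End ShiftsOfW.

(** * The field case *)

(* Additive form of Hilbert 90: with [Tr d <> 0], the weighted trace
   [sum_i i tau^i d] is shifted by [- Tr d] under [tau]. *)
Lemma cyclic_AS_generator (K : fieldType) (p : nat) (E : splittingFieldType K) :
  p \in [pchar K] -> galois 1%AS {:E} -> cyclic 'Gal({:E} / 1%AS) ->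
  #|'Gal({:E} / 1%AS)%g| = p ->
  exists (y : E) (k : K), y ^+ p - y = k%:A /\ y \notin 1%VS.
Proof.
move=> pcharK galE /cyclicP[x DgalE] card_gal.
have p_pr := pcharf_prime pcharK.
have pcharE : p \in [pchar E] by rewrite pchar_lalg.
have ox : #[x]%g = p by rewrite -card_gal DgalE.
have ox_gt1 : (1 < #[x]%g)%N by rewrite ox prime_gt1.
have galEx : x \in 'Gal({:E} / 1%AS)%g by rewrite DgalE cycle_id.
have fixP a : x a = a -> a \in 1%VS.
  move=> xa; rewrite -(galois_fixedField galE); apply/fixedFieldP=> [|y].
    exact: memvf.
  rewrite DgalE => /cycleP[i ->]; elim: i => [|i IHi]; first by rewrite gal_id.
  by rewrite expgSr galM ?memvf // IHi.
have [d _ trd_neq0] := @gal_independent_contra _ _ _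
  (fun y => y \in 'Gal({:E} / 1%AS)%g) (fun=> 1) _ (group1 _) (oner_neq0 E).
set t := \sum_(y in _) _ in trd_neq0.
have xt : x t = t.
  rewrite rmorph_sum [RHS](reindex_acts 'R _ galEx) ?astabsR //=.
  by apply: eq_bigr => y galEy; rewrite !mul1r galM ?memvf.
(* The exponent [i] with [y = x ^ i]; its image in [E] depends only on [y], as the order of [x] is
   the characteristic. *)
pose c_ y : E := (invm (injm_Zpm x) y : nat)%:R.
pose b := \sum_(y in 'Gal({:E} / 1%AS)%g) c_ y * y d.
have xb : b = x b + t.
  rewrite {1}/b (reindex_acts 'R _ galEx) ?astabsR //= -xt !rmorph_sum.
  rewrite -big_split; apply: eq_bigr => y galEy /=.
  rewrite galM ?memvf // mul1r rmorphM /= /c_ rmorph_nat -[X in _ + X]mul1r.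
  rewrite -mulrDl; congr (_ * _).
  have /morphimP[/= i _ _ ->] /=: y \in (Zpm @* Zp #[x])%g by rewrite im_Zpm -DgalE.
  have <-: Zpm (i + 1) = (Zpm i * x)%g by rewrite morphM ?mem_Zp //.
  rewrite !invmE ?mem_Zp ?ox_gt1 //= natr1.
  rewrite -[RHS](GRing.natr_mod_pchar pcharE) modnDmr addn1; congr (_%:R).
  by move: (nat_of_ord i) => j; rewrite Zp_cast // ox.
pose y := - b / t.
have xy : x y = y + 1.
  rewrite /y rmorphM rmorphN fmorphV /= xt {2}xb opprD mulrDl !mulNr divff //.
  by rewrite subrK.
have /vlineP[k yk] : y ^+ p - y \in 1%VS.
  apply: fixP; rewrite rmorphB rmorphXn /= xy -[X in _ ^+ X]expn1 exprpD //.
  by rewrite expr1n expn1 opprD addrACA subrr addr0.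
exists y, k; split=> //; apply/negP => y1.
have /eqP := fixed_gal (sub1v _) galEx y1.
by rewrite xy -subr_eq0 addrC addKr oner_eq0.
Qed.

Lemma irreducible_factor (F : fieldType) (q : {poly F}) : (1 < size q)%N ->
  exists2 g, irreducible_poly g & g %| q.
Proof.
elim: {q}(size q) {-2}q (leqnn (size q)) => [|m IH] q.
  by rewrite leqn0 => /eqP ->.
move=> le_q q_gt1; have [irr|red] := pselect (irreducible_poly q).
  by exists q.
have q_neq0 : q != 0 by rewrite -size_poly_gt0 ltnW.
have [r [r1 rq nrq]] :
    exists r : {poly F}, [/\ size r != 1%N, r %| q & ~~ (r %= q)].
  apply: contrapT => no_r; apply: red; split=> // r r1 rq.
  by apply: contraT => nrq; case: no_r; exists r.
have r_neq0 : r != 0 by apply: contraTneq rq => ->; rewrite dvd0p.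
have lt_r : (size r < size q)%N.
  by rewrite ltn_neqAle dvdp_leq // dvdp_size_eqp // nrq.
have [||g irr_g gr] := IH r.
- by rewrite -ltnS (leq_trans lt_r).
- by rewrite ltn_neqAle eq_sym r1 size_poly_gt0.
by exists g => //; apply: dvdp_trans gr rq.
Qed.

Lemma horner_alg_irreducible (F : fieldType) (B : comAlgType F) (x : B)
    (g q : {poly F}) : irreducible_poly g ->
  horner_alg x g = 0 -> horner_alg x q = 0 -> g %| q.
Proof.
move=> irr_g gx qx; apply: contraT; rewrite -irreducible_poly_coprime //.
case/Bezout_eq1_coprimepP=> -[u v] /= /(congr1 (horner_alg x)).
rewrite rmorphD !rmorphM rmorph1 /= gx qx !mulr0 addr0 => /eqP.
by rewrite eq_sym oner_eq0.
Qed.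

(** Over a prime field, closure under addition gives a subspace. The rows of [M] are the elements of
    [S], and a vector orthogonal to all of them is zero, so they span. *)
Lemma Fp_closed_subset_full (p n : nat) (S : {set 'rV['F_p]_n}) : prime p ->
  0 \in S -> (forall a b, a \in S -> b \in S -> a + b \in S) ->
  (forall e, e != 0 -> exists2 a, a \in S & dotv a e != 0) ->
  forall a, a \in S.
Proof.
move=> p_pr S0 SD Ssep a; pose M := \matrix_(i < #|S|) (enum_val i : 'rV['F_p]_n).
have fullM : row_full M.
  suff : row_free M^T by rewrite /row_free /row_full mxrank_tr.
  rewrite -kermx_eq0; apply/rowV0P => e /sub_kermxP eM.
  apply/eqP; apply: contraT => /Ssep[b Sb]; case/eqP.
  have /rowP/(_ (enum_rank_in Sb b)) := eM; rewrite !mxE => <-.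
  by apply: eq_bigr => i _; rewrite !mxE enum_rankK_in // mulrC.
have SZ (c : 'F_p) b : b \in S -> c *: b \in S.
  move=> Sb; rewrite -[c]natr_Zp scaler_nat; elim: (nat_of_ord c) => // m IH.
  by rewrite mulrS SD.
have /submxP[c ->] := submx_full a fullM; rewrite mulmx_sum_row.
by apply: (big_ind (fun b => b \in S)) => // i _; rewrite rowK SZ ?enum_valP.
Qed.

Section AlgebraIsField.
Variables (K : fieldType) (p : nat) (pcharK : p \in [pchar K]).
Variables (n : nat) (f : 'I_n.+1 -> K).
Let p_pr := pcharf_prime pcharK.
Local Notation H := (cohat p f).
Local Notation A := (AS_alg pcharK f).
Local Notation w := (AS_w pcharK f).
Local Notation wgen := (AS_gen pcharK f).
Local Notation sh := (AS_shift pcharK f).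
Local Notation pcharA := (AS_pchar pcharK f).
Local Notation Q := (AS_Q p f).
Hypothesis D_neq0 : moore p f != 0.
Hypothesis indep : forall eps : 'rV['F_p]_n.+1,
  AS_image p (Fp_comb eps f) -> eps = 0.

Section IrreducibleFactor.
Variables (g : {poly K}) (irr_g : irreducible_poly g) (gQ : g %| Q).
Variables (L : fieldExtType K) (x0 : L) (gx0 : horner_alg x0 g = 0).

Let z (a : 'rV['F_p]_n.+1) : K := Fp_comb a H.
Let x (a : 'rV['F_p]_n.+1) : L := x0 + (z a)%:A.
Let S := [set a | horner_alg (x a) g == 0].

Let x_inj : injective x.
Proof.
move=> a b /addrI /(fmorph_inj (GRing.in_alg L)).
by apply: (moore_neq0_inj pcharK); apply: moore_cohat_neq0.
Qed.

Let horner_x a q : horner_alg (x a) q = horner_alg x0 (q \Po ('X + (z a)%:P)).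
Proof. by rewrite horner_alg_comp rmorphD /= horner_algX horner_algC. Qed.

Let ev_w q : horner_alg w q = 0 -> horner_alg x0 q = 0.
Proof.
move/(horner_AS_w pcharK D_neq0)/(dvdp_trans gQ)/dvdpP=> [r ->].
by rewrite rmorphM /= gx0 mulr0.
Qed.

Let S0 : 0 \in S.
Proof. by rewrite inE /x /z (Fp_comb0 pcharK) scale0r addr0 gx0. Qed.

(** Irreducibility makes [g] divide its translate by [z a]; evaluate at the root [x b]. *)
Let SD a b : a \in S -> b \in S -> a + b \in S.
Proof.
rewrite !inE horner_x => /eqP ga /eqP gb.
have /dvdpP[r rE] := horner_alg_irreducible irr_g gx0 ga.
have -> : x (a + b) = x b + (z a)%:A.
  by rewrite /x /z (Fp_combD pcharK) scalerDl [_%:A + _]addrC addrA.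
have := congr1 (horner_alg (x b)) rE.
rewrite rmorphM /= gb mulr0 horner_alg_comp rmorphD /= horner_algX.
by rewrite horner_algC => ->.
Qed.

Let Qx a : horner_alg (x a) Q = 0.
Proof.
rewrite horner_x; apply: ev_w.
have w0 : horner_alg w Q = 0 by apply/(horner_AS_w pcharK D_neq0).
by rewrite -(AS_shift_horner pcharK) w0 rmorph0.
Qed.

(** Over [L], [Q] is the product of the distinct factors at the [x a], so [g] is a product of some
    of them, all with index in [S]. *)
Let size_g : (size g <= #|S|.+1)%N.
Proof.
have QE : map_poly (GRing.in_alg L) Q =
    \prod_(a <- enum {: 'rV['F_p]_n.+1}) ('X - (x a)%:P).
  rewrite -(big_map x xpredT (fun y => 'X - y%:P)).
  rewrite [LHS](@all_roots_prod_XsubC _ _ (map x (enum {: 'rV['F_p]_n.+1}))).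
  - by rewrite lead_coef_map (monicP (monic_AS_Q pcharK D_neq0)) rmorph1 scale1r.
  - rewrite size_map_poly (size_AS_Q pcharK) // size_map -cardE.
    by rewrite card_mx card_Fp // mul1n.
  - by apply/allP=> _ /mapP[a _ ->]; apply/rootP/Qx.
  by rewrite uniq_rootsE (map_inj_uniq x_inj) enum_uniq.
have : map_poly (GRing.in_alg L) g %| map_poly (GRing.in_alg L) Q.
  by rewrite dvdp_map.
rewrite QE => /dvdp_prod_XsubC[m gm].
rewrite -(size_map_poly (GRing.in_alg L)) (eqp_size gm) size_prod_XsubC ltnS.
rewrite cardE; apply: uniq_leq_size; first by rewrite mask_uniq ?enum_uniq.
move=> a am; rewrite mem_enum inE; apply/eqP.
have : root (map_poly (GRing.in_alg L) g) (x a).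
  rewrite (eqp_root gm) -(big_map x xpredT (fun y => 'X - y%:P)).
  by rewrite root_prod_XsubC map_f.
by move/rootP.
Qed.

(** Otherwise write the combination of generators given by [e] as [V] in [w]. Then [V] is constant
    on the roots [x a] with [a] in [S], and by [size_g] its remainder modulo [g] is a constant,
    necessarily with value in [K]. This value exhibits the combination of [f] as some [x^p - x],
    contradicting [indep]. *)
Let Ssep e : e != 0 -> exists2 a, a \in S & dotv a e != 0.
Proof.
move=> e_neq0; apply: contrapT => noS.
have Se a : a \in S -> dotv a e = 0.
  by move=> Sa; apply: contrapT => /eqP nz; apply: noS; exists a.
have [V Vw] := gen_AS_w D_neq0 (Fp_comb e wgen).
have VS a : a \in S -> horner_alg (x a) V = horner_alg x0 V.
  move=> Sa; rewrite horner_x; apply/eqP; rewrite -subr_eq0 -rmorphB.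
  apply/eqP/ev_w; rewrite rmorphB /= -(AS_shift_horner pcharK) -Vw AS_shift_comb.
  by rewrite Se // rmorph0 addr0 subrr.
pose V' := V %% g; have VE : V = V %/ g * g + V' by apply: divp_eq.
have g_neq0 : g != 0 by rewrite -size_poly_gt0 ltnW //; case: irr_g.
have V'S a : a \in S -> horner_alg (x a) V' = horner_alg x0 V.
  move=> Sa; rewrite -(VS a Sa) [in RHS]VE rmorphD rmorphM /=.
  by move: Sa; rewrite inE => /eqP ->; rewrite mulr0 add0r.
have V'E : map_poly (GRing.in_alg L) V' = (horner_alg x0 V)%:P.
  apply: (@poly_const_values _ _ (map x (enum S))).
  - by rewrite (map_inj_uniq x_inj) enum_uniq.
  - by rewrite size_map -cardE; apply/card_gt0P; exists 0.
  - rewrite size_map_poly size_map -cardE -ltnS (leq_trans _ size_g) //.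
    by rewrite ltn_modp.
  by move=> _ /mapP[a aS ->]; apply: V'S; rewrite -mem_enum.
have {V'E} vE : horner_alg x0 V = (V'`_0)%:A.
  have := congr1 (fun q : {poly L} => q`_0) V'E.
  by rewrite coef_map coefC /= => <-.
case/eqP: e_neq0; apply: indep; exists V'`_0.
apply: (fmorph_inj (GRing.in_alg L)); rewrite rmorphB rmorphXn /= -vE.
have := @ev_w (V ^+ p - V - (Fp_comb e f)%:P).
rewrite !rmorphB !rmorphXn /= !horner_algC -Vw AS_comb_AS subrr => /(_ erefl).
by move/subr0_eq => ->.
Qed.

Lemma factor_eqp_AS_Q : g %= Q.
Proof.
have Q_neq0 : Q != 0 by rewrite monic_neq0 ?monic_AS_Q.
rewrite -dvdp_size_eqp // eqn_leq dvdp_leq //= (size_AS_Q pcharK) //.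
have g_neq0 : g != 0 by rewrite -size_poly_gt0 ltnW //; case: irr_g.
have allS := Fp_closed_subset_full p_pr S0 SD Ssep.
have : (size (map x (enum {: 'rV['F_p]_n.+1})) <
        size (map_poly (GRing.in_alg L) g))%N.
  apply: max_poly_roots; first by rewrite map_poly_eq0.
    by apply/allP=> _ /mapP[a _ ->]; apply/rootP/eqP; have := allS a; rewrite inE.
  by rewrite (map_inj_uniq x_inj) enum_uniq.
by rewrite size_map_poly size_map -cardE card_mx card_Fp // mul1n.
Qed.

End IrreducibleFactor.

Lemma irreducible_AS_Q : irreducible_poly Q.
Proof.
have Q_neq0 : Q != 0 by rewrite monic_neq0 ?monic_AS_Q.
have sQ := size_AS_Q pcharK D_neq0.
split=> [|q q1 qQ]; first by rewrite sQ ltnS expn_gt0 prime_gt0.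
have q_neq0 : q != 0 by apply: contraTneq qQ => ->; rewrite dvd0p.
have [|g irr_g gq] := @irreducible_factor _ q.
  by rewrite ltn_neqAle eq_sym q1 size_poly_gt0.
have [L _ [x0 gx0 _]] := irredp_FAdjoin irr_g.
have gQ : g %= Q.
  by apply: factor_eqp_AS_Q (rootP gx0) => //; apply: dvdp_trans gq qQ.
by rewrite /eqp qQ /= (dvdp_trans _ gq) //; case/andP: gQ.
Qed.

Lemma AS_is_field : is_field A.
Proof.
move=> a; have [g ->] := gen_AS_w D_neq0 a => ga.
have : ~~ (Q %| g) by apply: contraNN ga => /(horner_AS_w pcharK D_neq0) ->.
rewrite -irreducible_poly_coprime; last exact: irreducible_AS_Q.
case/Bezout_eq1_coprimepP=> -[u v] /= /(congr1 (horner_alg w)).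
rewrite rmorphD !rmorphM rmorph1 /=.
have -> : horner_alg w Q = 0 by apply/(horner_AS_w pcharK D_neq0).
by rewrite mulr0 add0r mulrC; exists (horner_alg w v).
Qed.

End AlgebraIsField.

(** * Dimension modulo the Artin-Schreier image *)

Section QuotientDimension.
Variables (K : fieldType) (p : nat) (pcharK : p \in [pchar K]).
Let p_pr := pcharf_prime pcharK.
Local Notation W := (AS_image p).

Let frobD : {morph (fun x : K => x ^+ p - x) : x y / x + y}.
Proof.
move=> x y /=; rewrite -[X in _ ^+ X]expn1 exprpD // expn1 opprD.
by rewrite addrACA.
Qed.

Lemma AS_image0 : W (0 : K).
Proof. by exists 0; rewrite expr0n eqn0Ngt prime_gt0 // subrr. Qed.

Lemma AS_imageN (x : K) : W x -> W (- x).
Proof.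
case=> y ->; exists (- y); apply/eqP; rewrite eq_sym -addr_eq0 -frobD addNr.
by rewrite expr0n eqn0Ngt prime_gt0 ?subrr.
Qed.

Lemma AS_imageB (x y : K) : W x -> W y -> W (x - y).
Proof.
by move=> [u ->] /AS_imageN[v ->]; exists (u + v); rewrite frobD.
Qed.

Lemma AS_image_comb n (c : 'rV['F_p]_n) (v : 'I_n -> K) :
  (forall i, W (v i)) -> W (Fp_comb c v).
Proof.
case/choice=> u uE; exists (Fp_comb c u).
rewrite (additive_Fp_comb _ _ frobD); apply: eq_bigr => i _.
by rewrite uE.
Qed.

(** [T] gives the coordinates of the class of a combination of [f]; it is onto, with section [S],
    because the basis consists of classes of such combinations. For [r = n] finiteness makes [T]
    bijective, so its kernel is trivial; conversely, injectivity of [S] and [T] compares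
    cardinalities both ways. *)
Lemma quot_dim_indep n (f : 'I_n -> K) r :
  has_Fp_quot_dim p
    (fun x => exists eps : 'rV['F_p]_n, W (x - Fp_comb eps f)) W r ->
  r = n <-> (forall eps : 'rV['F_p]_n, W (Fp_comb eps f) -> eps = 0).
Proof.
case=> b [bV bU].
have TU (eps : 'rV['F_p]_n) :
    exists! c : 'rV['F_p]_r, W (Fp_comb eps f - Fp_comb c b).
  by apply: bU; exists eps; rewrite subrr; apply: AS_image0.
have /choice[T TP] (eps : 'rV['F_p]_n) : exists c : 'rV['F_p]_r,
    W (Fp_comb eps f - Fp_comb c b).
  by have [c [cP _]] := TU eps; exists c.
have TE eps c : W (Fp_comb eps f - Fp_comb c b) -> T eps = c.
  by have [c' [_ cU]] := TU eps => /cU <-; apply/esym/cU/TP.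
have /choice[S SK] (c : 'rV['F_p]_r) : exists eps, T eps = c.
  have /choice[e eP] := bV; exists (Fp_comb c e); apply: TE.
  rewrite (additive_Fp_comb (phi := fun u => Fp_comb u f)); last first.
    by move=> u v; rewrite (Fp_combD pcharK).
  rewrite /Fp_comb -sumrB; under eq_bigr do rewrite -mulrnBl.
  by apply: AS_image_comb => i; rewrite -opprB; apply/AS_imageN/eP.
have S_inj : injective S by apply: can_inj SK.
split=> [rn | indep].
  move: rn => /esym rn; case: r / rn b bV bU TU T TP TE S SK S_inj.
  move=> b bV bU TU T TP TE S SK S_inj eps Weps.
  have TS : cancel T S by apply/(bij_can_sym (injF_bij S_inj)).
  have T0 : T 0 = 0.
    by apply: TE; rewrite !(Fp_comb0 pcharK) subrr; apply: AS_image0.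
  rewrite -[eps]TS -[RHS]TS T0; congr S; apply: TE.
  by rewrite (Fp_comb0 pcharK) subr0.
have T_inj : injective T.
  move=> e e' Tee'; apply/eqP; rewrite -subr_eq0; apply/eqP/indep.
  rewrite (Fp_combD pcharK) (Fp_combN pcharK).
  by have := AS_imageB (TP e) (TP e'); rewrite Tee' opprB addrA subrK.
apply/eqP; rewrite -(@eqn_exp2l p) ?prime_gt1 // eqn_leq.
have := leq_card _ T_inj; have := leq_card _ S_inj.
by rewrite !card_mx !card_Fp // !mul1n => -> ->.
Qed.

End QuotientDimension.

Section FieldCase.
Variables (K : fieldType) (p : nat) (pcharK : p \in [pchar K]).
Variables (n : nat) (f : 'I_n -> K).
Let p_pr := pcharf_prime pcharK.
Local Notation A := (AS_alg pcharK f).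
Local Notation wgen := (AS_gen pcharK f).
Local Notation sh := (AS_shift pcharK f).
Local Notation pcharA := (AS_pchar pcharK f).
Local Notation w_ eps := (Fp_comb eps wgen).
Hypothesis fieldA : is_field A.

Lemma is_field_mul_eq0 (a b : A) : a * b = 0 -> a = 0 \/ b = 0.
Proof.
move=> ab0; have [->|/fieldA[c ac]] := eqVneq a 0; first by left.
by right; rewrite -[b]mul1r -ac mulrAC ab0 mul0r.
Qed.

(** The polynomial [X^p - X] is the product of the [X - c] over the prime field, and without zero
    divisors one factor must vanish at [x]. *)
Lemma frob_fixed (x : A) : x ^+ p = x -> exists c : 'F_p, x = Fpr pcharA c.
Proof.
move=> xp; have : \prod_(c : 'F_p) (x - Fpr pcharA c) = 0.
  have := congr1 (fun q => (map_poly (Fpr pcharA) q).[x]) (finField_genPoly 'F_p).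
  rewrite card_Fp // rmorphB rmorphXn /= map_polyX !hornerE xp subrr => E.
  rewrite [RHS]E rmorph_prod horner_prod; apply: eq_bigr => c _.
  by rewrite rmorphB /= map_polyX map_polyC !hornerE.
elim: (index_enum _) => [|c s IHs]; rewrite ?big_nil ?big_cons.
  by move/eqP; rewrite oner_eq0.
by case/is_field_mul_eq0=> [/subr0_eq ->|/IHs //]; exists c.
Qed.

Lemma field_Kaut_shift (s : A -> A) : is_Kaut s -> exists a, s =1 sh a.
Proof.
case=> _ [phi sphi].
have /choice[c cP] k : exists c : 'F_p, phi (wgen k) = wgen k + Fpr pcharA c.
  have [|c cE] := @frob_fixed (phi (wgen k) - wgen k).
    rewrite -[X in _ ^+ X]expn1 (exprpB pcharA) expn1 -rmorphXn /= AS_genE rmorphD /=.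
    by rewrite rmorph_alg opprD addrACA subrr addr0.
  by exists c; rewrite -cE addrC subrK.
exists (\row_k c k) => x; rewrite sphi; apply: AS_ext => k.
by rewrite AS_shiftE mxE cP.
Qed.

(** If the combination of [f] is [x^p - x], then [w_ eps - x] is fixed by Frobenius, so [w_ eps] is
    a scalar and no shift moves it; for [eps != 0] some shift moves it by 1. *)
Lemma field_indep (eps : 'rV['F_p]_n) : AS_image p (Fp_comb eps f) -> eps = 0.
Proof.
case=> x fE; have [|c cE] := @frob_fixed (w_ eps - x%:A).
  rewrite -[X in _ ^+ X]expn1 (exprpB pcharA) expn1 exprZn expr1n.
  have := AS_comb_AS pcharK f eps; rewrite fE scalerBl => /eqP.
  by rewrite subr_eq => /eqP ->; rewrite addrAC [X in X + _]addrAC subrr add0r addrC.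
apply/eqP; apply: contraT => /(dotv_surj 1)[a a1].
have := AS_shift_comb pcharK f a eps; rewrite a1 rmorph1.
rewrite -[w_ eps](subrK x%:A) cE FprA -scalerDl rmorph_alg => /eqP.
by rewrite -subr_eq0 opprD addNKr oppr_eq0 oner_eq0.
Qed.

Lemma AS_poly_irreducible (eps : 'rV['F_p]_n) :
  eps != 0 -> irreducible_poly (AS_poly f eps).
Proof.
move=> eps_neq0; have kerE g := horner_AS_comb pcharK f g eps_neq0.
have h_neq0 : AS_poly f eps != 0 by rewrite monic_neq0 ?(monic_AS_poly pcharK).
split=> [|q q1 qh]; first by rewrite (size_AS_poly pcharK) ltnS prime_gt0.
have /dvdpP[r rE] := qh.
have [] : horner_alg (w_ eps) r = 0 \/ horner_alg (w_ eps) q = 0.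
- by apply: is_field_mul_eq0; rewrite -rmorphM -rE; apply/kerE.
- move/kerE => hr; case/eqP: q1; have r_neq0 : r != 0.
    by apply: contraNneq h_neq0; rewrite rE => ->; rewrite mul0r.
  have := dvdp_leq r_neq0 hr; rewrite rE.
  have q_neq0 : q != 0 by apply: contraNneq h_neq0; rewrite rE => ->; rewrite mulr0.
  rewrite size_mul //; move: q_neq0 r_neq0; rewrite -!size_poly_gt0; lia.
by move/kerE => hq; rewrite /eqp qh hq.
Qed.

Lemma gen_alg_adjoin (E : fieldExtType K) (y : E) :
  <<1; y>>%VS = fullv -> forall b : E, gen_alg y b.
Proof.
move=> yE b; have : b \in <<1%AS; y>>%VS by rewrite yE memvf.
by case/Fadjoin_polyP=> _ /polyOver1P[q ->] ->; exists q.
Qed.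

(** Adjoin a root [x0] of [AS_poly]. The other roots are its translates by the prime field, so the
    extension is Galois of prime degree [p]; it maps to [A] by [x0 |-> w_ eps]. *)
Lemma pcyclic_gen (eps : 'rV['F_p]_n) : eps != 0 ->
  is_pcyclic_ext p (gen_alg (w_ eps)).
Proof.
move=> eps_neq0; have irr_h := AS_poly_irreducible eps_neq0.
have [L dimL [x0 /rootP hx0 genL]] := irredp_FAdjoin irr_h.
have {}hx0 : horner_alg x0 (AS_poly f eps) = 0 by [].
have pcharL : p \in [pchar L] by rewrite pchar_lalg.
pose rs := [seq x0 + Fpr pcharL c | c : 'F_p].
pose h := map_poly (GRing.in_alg L) (AS_poly f eps).
have rs_uniq : uniq rs.
  by rewrite map_inj_uniq ?enum_uniq // => c d /addrI/fmorph_inj.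
have hE : h = \prod_(z <- rs) ('X - z%:P).
  rewrite [LHS](@all_roots_prod_XsubC _ _ rs).
  - by rewrite lead_coef_map (monicP (monic_AS_poly pcharK _ _)) rmorph1 scale1r.
  - by rewrite size_map_poly (size_AS_poly pcharK) size_map -cardE card_Fp.
  - apply/allP => _ /mapP[c _ ->]; apply/rootP.
    rewrite -[LHS]/(horner_alg _ _) -[RHS]hx0 /AS_poly !rmorphB !rmorphXn /=.
    rewrite !horner_algX !horner_algC -[X in _ ^+ X]expn1 exprpD // expn1.
    by rewrite Fpr_frob opprD addrACA subrr addr0.
  by rewrite uniq_rootsE.
have h1 : h \is a polyOver 1%VS by apply/polyOver1P; exists (AS_poly f eps).
have splitL : splittingFieldFor 1 h {:L}.
  exists rs; first by rewrite hE eqpxx.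
  apply/eqP; rewrite eqEsubv subvf -genL /=; apply/FadjoinP; split.
    exact: subv_adjoin_seq.
  apply: seqv_sub_adjoin; apply/mapP; exists 0; first by rewrite mem_enum.
  by rewrite rmorph0 addr0.
pose E : splittingFieldType K :=
  HB.pack L (FieldExt_isSplittingField.Build K L (ex_intro2 _ _ h h1 splitL)).
have galE : galois 1%AS {:E}.
  apply/splitting_galoisField; exists h; split=> //.
  by rewrite hE separable_prod_XsubC.
have cardE : #|'Gal({:E} / 1%AS)%g| = p.
  by rewrite -galois_dim // dimv1 divn1 dimL (size_AS_poly pcharK).
have [|phi phiE] := @gen_alg_morph K L A x0 (w_ eps) (gen_alg_adjoin genL).
  move=> g gx0; apply/horner_AS_comb => //.
  exact: horner_alg_irreducible irr_h hx0 gx0.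
exists E, phi; split=> //.
- move=> a; split=> [[g ->]|[b ->]]; first by exists (horner_alg x0 g); rewrite phiE.
  by have [g ->] := gen_alg_adjoin genL b; exists g; rewrite phiE.
- by apply: prime_cyclic; rewrite cardE.
Qed.

Lemma gen_alg_scale c (eps : 'rV['F_p]_n) : gen_alg (w_ eps) (w_ (c *: eps)).
Proof.
exists (Fpr pcharK c *: 'X).
by rewrite (Fp_combZ pcharA) FprA mulr_algl horner_algZ horner_algX.
Qed.

Lemma gen_alg_scale_iff c (eps : 'rV['F_p]_n) a : c != 0 ->
  gen_alg (w_ (c *: eps)) a <-> gen_alg (w_ eps) a.
Proof.
move=> c_neq0; split; apply: gen_alg_trans; first exact: gen_alg_scale.
by rewrite -{2}[eps](scalerK c_neq0); apply: gen_alg_scale.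
Qed.

(** A shift fixing [w_ e] fixes everything it generates, so the kernel of the functional [e] lies in
    that of [e']. *)
Lemma gen_alg_comb_proportional (e e' : 'rV['F_p]_n) : e != 0 ->
  gen_alg (w_ e) (w_ e') -> exists c, e' = c *: e.
Proof.
move=> e_neq0 [g gE]; apply: dotv_proportional => // a ae.
have := AS_shift_comb pcharK f a e'; rewrite gE lrmorph_horner AS_shift_comb ae.
rewrite rmorph0 addr0 => /eqP; rewrite -subr_eq0 opprD addNKr oppr_eq0.
by rewrite fmorph_eq0 => /eqP.
Qed.

End FieldCase.

Lemma Fp_functional (p n : nat) (c : 'rV['F_p]_n -> 'F_p) :
  {morph c : a b / a + b} -> exists e, forall a, c a = dotv a e.
Proof.
move=> cD; exists (\row_i c (delta_mx 0 i)) => a.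
have aE : a = Fp_comb a (fun i => delta_mx 0 i : 'rV['F_p]_n).
  rewrite {1}[a]row_sum_delta; apply: eq_bigr => i _.
  by rewrite -{1}[a 0 i]natr_Zp scaler_nat.
rewrite {1}aE (additive_Fp_comb _ _ cD); apply: eq_bigr => i _.
by rewrite mxE -[in RHS](natr_Zp (a 0 i)) mulr_natl.
Qed.

Lemma pcyclic_ext_iff (K : fieldType) (A : comAlgType K) p (V V' : A -> Prop) :
  (forall a, V a <-> V' a) -> is_pcyclic_ext p V -> is_pcyclic_ext p V'.
Proof.
move=> VV' [E [phi [Vphi galE cycE cardE]]]; exists E, phi; split=> // a.
by rewrite -VV'.
Qed.

(** * Classification of the [p]-cyclic subextensions *)

Section PcyclicSubextensions.
Variables (K : fieldType) (p : nat) (pcharK : p \in [pchar K]).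
Variables (n : nat) (f : 'I_n.+1 -> K).
Let p_pr := pcharf_prime pcharK.
Local Notation A := (AS_alg pcharK f).
Local Notation wgen := (AS_gen pcharK f).
Local Notation sh := (AS_shift pcharK f).
Local Notation pcharA := (AS_pchar pcharK f).
Local Notation w_ eps := (Fp_comb eps wgen).
Hypothesis D_neq0 : moore p f != 0.
Hypothesis fieldA : is_field A.

(* Kummer-type argument: the shifts move an Artin-Schreier generator by a
   linear functional, which is realised by some [w_ eps]. *)
Lemma pcyclic_is_gen (V : A -> Prop) : is_pcyclic_ext p V ->
  exists2 eps : 'rV['F_p]_n.+1, eps != 0 & forall a, V a <-> gen_alg (w_ eps) a.
Proof.
case=> E [phi [Vphi galE cycE cardE]].
have [y [k [yk y1]]] := cyclic_AS_generator pcharK galE cycE cardE.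
have /choice[c cP] a : exists c : 'F_p, sh a (phi y) = phi y + Fpr pcharA c.
  have [|c cE] := @frob_fixed _ _ pcharK _ f fieldA (sh a (phi y) - phi y).
    have yp : phi y ^+ p = k%:A + phi y.
      have yp : y ^+ p = k%:A + y by rewrite -yk subrK.
      by rewrite -rmorphXn yp [LHS]rmorphD /= rmorph_alg.
    rewrite -[X in _ ^+ X]expn1 (exprpB pcharA) expn1 -rmorphXn /= yp.
    by rewrite rmorphD /= rmorph_alg opprD addrACA subrr add0r.
  by exists c; rewrite -cE addrC subrK.
have [a b | eps epsE] := @Fp_functional p n.+1 c.
  apply: (fmorph_inj (Fpr pcharA)); apply: (addrI (phi y)).
  rewrite -cP AS_shiftD /= cP rmorphD /= cP rmorphD -addrA; congr (_ + (_ + _)).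
  by rewrite /Fpr rmorph_nat.
have [l lE] : exists l : K, phi y - w_ eps = l%:A.
  apply: AS_fixed => // a; rewrite rmorphB /= cP AS_shift_comb epsE.
  by rewrite opprD addrACA subrr addr0.
have yE : phi y = w_ eps + l%:A by rewrite -lE addrC subrK.
have wE : w_ eps = phi (y - l%:A) by rewrite rmorphB /= rmorph_alg yE addrK.
(* The degree is prime, so an element outside [K] generates. *)
have gen_y b : gen_alg y b.
  apply: gen_alg_adjoin; apply/eqP.
  rewrite -(dimv_leqif_eq (subvf _)).2.
  have dimE : \dim {:E} = p by rewrite -cardE -galois_dim // dimv1 divn1.
  have : (\dim <<1%AS; y>>%AS %| p)%N.
    by rewrite -dimE [X in (_ %| X)%N](dim_sup_field (subvf <<1%AS; y>>%AS)) dvdn_mull.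
  case/primeP: (p_pr) => _ /[apply] /orP[/eqP dim1|/eqP ->]; last by rewrite dimE.
  case/negP: y1; have : (1%VS == <<1; y>>%VS) by
    rewrite -(dimv_leqif_eq (subv_adjoin _ _)).2 dimv1 dim1.
  by move/eqP=> ->; apply: memv_adjoin.
exists eps => [|a].
  apply: contraNneq y1 => eps0; apply/vlineP; exists l.
  apply: (fmorph_inj phi); rewrite /= rmorph_alg yE eps0.
  by rewrite (Fp_comb0 pcharA) add0r.
rewrite Vphi; split=> [[b ->]|[g ->]].
  have [g ->] := gen_y b; rewrite lrmorph_horner yE.
  exists (g \Po ('X + l%:P)).
  by rewrite horner_alg_comp rmorphD /= horner_algX horner_algC.
by exists (horner_alg (y - l%:A) g); rewrite lrmorph_horner wE.
Qed.

Lemma pcyclic_reps (E : {set 'rV['F_p]_n.+1}) (V : A -> Prop) : proj_reps E ->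
  (exists2 eps, eps \in E & forall a, V a <-> gen_alg (w_ eps) a) <->
  is_pcyclic_ext p V.
Proof.
case=> E0 Erep; split=> [[eps epsE VE]|/pcyclic_is_gen[eps eps_neq0 VE]].
  apply: (@pcyclic_ext_iff _ _ _ (gen_alg (w_ eps))) => [a|]; first by rewrite VE.
  by apply: pcyclic_gen => //; apply: contraNneq E0 => <-.
have [e [[eE [c c_neq0 epsE]] _]] := Erep _ eps_neq0.
by exists e => // a; rewrite VE epsE gen_alg_scale_iff.
Qed.

End PcyclicSubextensions.

(** * Representatives of the projective space *)

Section ProjectiveRepresentatives.
Variables (p n : nat) (p_pr : prime p).
Implicit Types v e : 'rV['F_p]_n.

Lemma proj_reps_exists : exists E : {set 'rV['F_p]_n}, proj_reps E.
Proof.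
(* Scaling preserves the support, hence the coordinate that [pick] selects, which is normalised to
   1. *)
pose nrm v := if [pick k | v 0 k != 0] is Some k then (v 0 k)^-1 *: v else v.
have nrmZ c v : c != 0 -> nrm (c *: v) = nrm v.
  move=> c_neq0; rewrite /nrm (@eq_pick _ _ (fun k => v 0 k != 0)); last first.
    by move=> k /=; rewrite mxE mulf_eq0 negb_or c_neq0.
  case: pickP => [k vk|v0]; last first.
    suff -> : v = 0 by rewrite scaler0.
    by apply/rowP => k; have /negbFE/eqP := v0 k; rewrite mxE.
  by rewrite mxE scalerA invfM mulrAC mulVf // mul1r.
have nrmE v : v != 0 -> exists2 c, c != 0 & v = c *: nrm v.
  case/rV0Pn=> k0 vk0; rewrite /nrm; case: pickP => [k vk|/(_ k0)].
    by exists (v 0 k) => //; rewrite scalerA mulfV ?scale1r.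
  by rewrite vk0.
exists [set v | (v != 0) && (nrm v == v)]; split; first by rewrite inE eqxx.
move=> v v_neq0; have [c c_neq0 vE] := nrmE v v_neq0; exists (nrm v); split.
  split; last by exists c.
  rewrite inE -(nrmZ c (nrm v)) // -vE eqxx andbT.
  by apply: contraNneq v_neq0 => nv0; rewrite vE nv0 scaler0.
by move=> e [] /[!inE] /andP[_ /eqP nE] [d d_neq0 ->]; rewrite nrmZ.
Qed.

(** Multiplication maps the pairs of a nonzero scalar and a representative bijectively onto the
    nonzero vectors. *)
Lemma card_proj_reps (E : {set 'rV['F_p]_n}) : proj_reps E ->
  #|E| = ((p ^ n - 1) %/ (p - 1))%N.
Proof.
case=> E0 Erep.
have nzE e : e \in E -> e != 0 by apply: contraTneq => ->.
pose X := setX [set c : 'F_p | c != 0] E.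
have X_inj : {in X &, injective (fun x => x.1 *: x.2)}.
  move=> [c e] [c' e'] /[!inE] /= /andP[c0 eE] /andP[c'0 e'E] ce.
  have v0 : c *: e != 0 by rewrite scaler_eq0 negb_or c0 nzE.
  have [e1 [_ eU]] := Erep _ v0.
  have ee : e = e'.
    rewrite -(eU e); last by split=> //; exists c.
    by rewrite -(eU e') //; split=> //; exists c'.
  rewrite -ee in ce *; congr (_, _).
  have /rV0Pn[k ek] := nzE e eE.
  by have /rowP/(_ k) := ce; rewrite !mxE => /(mulIf ek).
have : #|(fun x => x.1 *: x.2) @: X| = (p ^ n - 1)%N.
  have -> : (fun x : 'F_p * 'rV['F_p]_n => x.1 *: x.2) @: X = [set~ 0].
    apply/setP=> v; rewrite !inE; apply/imsetP/idP => [[[c e]]|v0].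
      by rewrite !inE /= => /andP[c0 eE] ->; rewrite scaler_eq0 negb_or c0 nzE.
    have [e [[eE [c c0 vE]] _]] := Erep v v0; exists (c, e) => //.
    by rewrite !inE c0.
  by rewrite cardsC1 card_mx card_Fp // mul1n subn1.
rewrite card_in_imset // cardsX.
have -> : [set c : 'F_p | c != 0] = [set~ 0] by apply/setP=> c; rewrite !inE.
rewrite cardsC1 card_Fp // -subn1 => <-; rewrite mulKn //.
by rewrite subn_gt0 prime_gt1.
Qed.

End ProjectiveRepresentatives.

(** * The automorphisms [sigma z] *)

Section Automorphisms.
Variables (K : fieldType) (p : nat) (pcharK : p \in [pchar K]).
Variables (n : nat) (f : 'I_n.+1 -> K).
Let p_pr := pcharf_prime pcharK.
Local Notation H := (cohat p f).
Local Notation A := (AS_alg pcharK f).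
Local Notation w := (AS_w pcharK f).
Local Notation sh := (AS_shift pcharK f).
Local Notation Z := (Fp_span p (hat_moore p f)).
Hypothesis D_neq0 : moore p f != 0.

Lemma hat_spanP z :
  reflect (exists a : 'rV['F_p]_n.+1, z = Fp_comb a H) (z \in Z).
Proof.
apply: (iffP (Fp_spanP _ _ _)) => [[e ->]|[a ->]].
  by exists (altv e); rewrite Fp_comb_altv.
by exists (altv a); rewrite -Fp_comb_altv // altvK.
Qed.

Lemma cohat_inj : injective (fun a : 'rV['F_p]_n.+1 => Fp_comb a H).
Proof. by apply: (moore_neq0_inj pcharK); apply: moore_cohat_neq0. Qed.

(* Outside [Z] the value is irrelevant; it is the identity. *)
Definition AS_sigma (z : K) : {lrmorphism A -> A} :=
  sh (odflt 0 [pick a : 'rV['F_p]_n.+1 | Fp_comb a H == z]).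

Lemma AS_sigmaE a : AS_sigma (Fp_comb a H) = sh a.
Proof.
rewrite /AS_sigma; case: pickP => [b /eqP/cohat_inj ->//|/(_ a)].
by rewrite eqxx.
Qed.

Definition AS_group (s : A -> A) : Prop := exists2 z, z \in Z & s =1 AS_sigma z.

Lemma AS_groupP s : AS_group s <-> exists a, s =1 sh a.
Proof.
split=> [[_ /hat_spanP[a ->]]|[a sa]].
  by rewrite AS_sigmaE; exists a.
by exists (Fp_comb a H); [apply/hat_spanP; exists a | rewrite AS_sigmaE].
Qed.

Lemma AS_shift_Kaut a : is_Kaut (sh a).
Proof. by split; [exact: AS_shift_bij | exists (sh a)]. Qed.

Lemma eq_is_Kaut (s t : A -> A) : s =1 t -> is_Kaut t -> is_Kaut s.
Proof.
move=> st [bij_t [phi tphi]]; split; first exact: eq_bij bij_t _ (fsym st).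
by exists phi => x; rewrite st.
Qed.

Lemma AS_group_subgroup : is_Kaut_subgroup AS_group.
Proof.
split=> [s /AS_groupP[a sa]||s t /AS_groupP[a sa] /AS_groupP[b tb]|].
- exact: eq_is_Kaut sa (AS_shift_Kaut a).
- by apply/AS_groupP; exists 0 => x; rewrite AS_shift0.
- by apply/AS_groupP; exists (a + b) => x; rewrite AS_shiftD /= sa tb.
move=> s t /AS_groupP[a sa] sK tK; apply/AS_groupP; exists (- a) => x.
apply: (can_inj sK); rewrite tK sa -[RHS]/((sh a \o sh (- a)) x).
by rewrite -AS_shiftD subrr AS_shift0.
Qed.

Lemma AS_group_iso : iso_Zp_pow p n.+1 AS_group.
Proof.
(* For prime [p] this identifies ['Z_p] with ['F_p], so the shifts themselves serve as [theta]. *)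
rewrite /iso_Zp_pow -(Fp_Zcast p_pr); exists sh; split.
- exact: AS_groupP.
- exact: AS_shiftD.
- exact: AS_shift_inj.
Qed.

(** The subextensions are indexed by a set of representatives; two equal ones have proportional
    indices, hence the same representative. *)
Lemma has_card_pcyclic : is_field A ->
  has_card (@is_pcyclic_ext K A p) ((p ^ n.+1 - 1) %/ (p - 1)).
Proof.
move=> fieldA; have [E repE] := @proj_reps_exists p n.+1.
rewrite -(card_proj_reps p_pr repE).
have nzE e : e \in E -> e != 0 by case: repE => E0 _; apply: contraTneq => ->.
exists (fun i a => gen_alg (Fp_comb (enum_val i) (AS_gen pcharK f)) a); split.
  by move=> i; apply: pcyclic_gen => //; rewrite nzE ?enum_valP.
move=> V /(pcyclic_reps D_neq0 fieldA V repE)[e eE VE].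
exists (enum_rank_in eE e); split; first by rewrite enum_rankK_in.
move=> i iE; apply: enum_val_inj; rewrite enum_rankK_in //.
have [||c eiE] := @gen_alg_comb_proportional _ _ pcharK _ f (enum_val i) e.
- by rewrite nzE ?enum_valP.
- by apply/iE/VE/gen_alg_self.
have e_neq0 := nzE e eE.
have [e1 [_ eU]] := repE.2 e e_neq0.
rewrite -(eU e) //; last by split=> //; exists 1; rewrite ?oner_neq0 ?scale1r.
apply: eU; split; first exact: enum_valP.
exists c => //; apply: contraNneq e_neq0 => c0.
by rewrite eiE c0 scale0r.
Qed.

(** The root condition forces [u = (z / D)^p], so [elkiesE] gives the pairing; its sign cancels the
    one in the conclusion. *)
Lemma AS_sigma_elkies (L : closedFieldType) (iota : {rmorphism K -> L}) z u
    (eps : 'rV['F_p]_n.+1) :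
  z \in Z -> iota z = iota (moore p f) * closed_root p (iota u) ->
  exists2 e : 'F_p, (e : nat)%:R = elkies p f iota (Fp_comb eps f) u &
    AS_sigma z (Fp_comb eps (AS_gen pcharK f)) =
      Fp_comb eps (AS_gen pcharK f) + (-1) ^+ n * (e : nat)%:R.
Proof.
case/hat_spanP=> a ->{z} zE; exists ((-1) ^+ n * dotv a eps).
  suff -> : u = (Fp_comb a H / moore p f) ^+ p by rewrite (elkiesE pcharK).
  apply: (fmorph_inj iota); rewrite rmorphXn rmorphM fmorphV /= zE.
  by rewrite mulrAC mulfV ?fmorph_eq0 // mul1r closed_rootK ?prime_gt0.
rewrite AS_sigmaE AS_shift_comb -/(Fpr (AS_pchar pcharK f) _) rmorphM rmorph_sign.
by rewrite mulrA -expr2 -exprM muln2 -mul2n exprM sqrrN !expr1n mul1r.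
Qed.

End Automorphisms.

Theorem corollary5p1 (K : fieldType) (p : nat) (pcharK : p \in [pchar K])
    (n : nat) (n_gt0 : (0 < n)%N) (f : 'I_n -> K)
    (f_moore : moore p f != 0) :
  let A := AS_alg pcharK f in
  let w := AS_w pcharK f in
  let w_ := fun eps : 'rV['F_p]_n => Fp_comb eps (AS_gen pcharK f) in
  let f_ := fun eps : 'rV['F_p]_n => Fp_comb eps f in
  let Z := Fp_span p (hat_moore p f) in
  let U := spaceU p f in
  [/\ (* A = K[w] ~ K[W]/(Q), w corresponding to the class of W *)
      (forall a : A, gen_alg w a) /\ quot_iso (AS_Q p f) (fun _ : A => True) w,
      (* the sums defining F and Z are direct *)
      injective (fun eps : 'rV['F_p]_n => Fp_comb eps f) /\
      injective (fun eps : 'rV['F_p]_n => Fp_comb eps (hat_moore p f))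
    & exists sigma : K -> {lrmorphism A -> A},
      let G := fun s : A -> A => exists2 z, z \in Z & s =1 sigma z in
      [/\ (* (1) *)
          [/\ forall z, z \in Z -> is_Kaut (sigma z) /\
                forall g : {poly K}, sigma z (horner_alg w g) =
                                     horner_alg w (g \Po ('X + z%:P)),
              forall z z', z \in Z -> z' \in Z ->
                z + z' \in Z /\ sigma (z + z') =1 sigma z \o sigma z',
              forall z z', z \in Z -> z' \in Z -> sigma z =1 sigma z' -> z = z',
              is_Kaut_subgroup G
            & iso_Zp_pow p n G],
          (* (2) *)
          [/\ forall x, root (rev_span_poly p f) x = (x \in U),
              forall eps : 'rV['F_p]_n, eps != 0 ->
                [/\ w_ eps ^+ p - w_ eps = (f_ eps)%:A,
                    quot_iso ('X^p - 'X - (f_ eps)%:P)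
                             (gen_alg (w_ eps)) (w_ eps),
                    is_subalg (gen_alg (w_ eps))
                  & has_Kdim (gen_alg (w_ eps)) p]
            & forall (L : closedFieldType) (iota : {rmorphism K -> L}),
                is_alg_closure iota ->
                [/\ forall y : L, root (map_poly iota (rev_span_poly p f)) y ->
                      exists2 u, u \in U & y = iota u,
                    forall z, z \in Z ->
                      exists2 u, u \in U &
                        iota z = iota (moore p f) * closed_root p (iota u)
                  & forall z u, z \in Z -> u \in U ->
                      iota z = iota (moore p f) * closed_root p (iota u) ->
                      forall eps : 'rV['F_p]_n, eps != 0 ->
                      exists2 e : 'F_p,
                        (e : nat)%:R = elkies p f iota (f_ eps) u &
                        sigma z (w_ eps) =
                          w_ eps + (-1) ^+ n.-1 * (e : nat)%:R]]
        & (* (3) *)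
          forall r : nat,
            has_Fp_quot_dim p
              (fun x => exists eps : 'rV['F_p]_n, AS_image p (x - f_ eps))
              (AS_image p) r ->
            (r = n <-> is_field A /\ forall s : A -> A, is_Kaut s -> G s) /\
            (r = n ->
              has_card (@is_pcyclic_ext K A p) ((p ^ n - 1) %/ (p - 1)) /\
              forall E : {set 'rV['F_p]_n}, proj_reps E ->
                forall V : A -> Prop,
                  (exists2 eps, eps \in E &
                     forall a, V a <-> gen_alg (w_ eps) a) <->
                  is_pcyclic_ext p V)]].
Proof.
move=> A w w_ f_ Z U.
(* From here the number of generators is [n.+1], so the exponent [n.-1] of the statement becomes
   [n]. *)
case: n n_gt0 f f_moore @A @w @w_ @f_ @Z @U => // n _ f D_neq0 A w w_ f_ Z U.
have p_pr := pcharf_prime pcharK.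
have [c_top c_f] := span_coefP pcharK D_neq0.
have h_neq0 : moore p (hat_moore p f) != 0 by apply: moore_hat_neq0 c_f _.
split.
- by split; [exact: gen_AS_w | exact: quot_iso_AS_w].
- by split; exact: (moore_neq0_inj pcharK).
exists (AS_sigma pcharK f); split.
- split.
  + move=> _ /(hat_spanP pcharK)[a ->]; rewrite AS_sigmaE //; split=> [|g].
      exact: AS_shift_Kaut.
    by rewrite AS_shift_horner.
  + move=> _ _ /(hat_spanP pcharK)[a ->] /(hat_spanP pcharK)[b ->].
    rewrite -(Fp_combD pcharK) !AS_sigmaE //; split; last exact: AS_shiftD.
    by apply/(hat_spanP pcharK); exists (a + b).
  + move=> _ _ /(hat_spanP pcharK)[a ->] /(hat_spanP pcharK)[b ->].
    by rewrite !AS_sigmaE // => /AS_shift_inj ->.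
  + exact: AS_group_subgroup.
  + exact: AS_group_iso.
- split.
  + exact: root_rev_span_poly.
  + by move=> eps /(AS_comb_properties pcharK f).
  + move=> L iota _; split.
    * exact: root_map_rev_span_poly.
    * move=> z zZ; exists ((z / moore p f) ^+ p).
        by apply/mapP; exists z.
      have pcharL : p \in [pchar L] by rewrite (fmorph_pchar iota).
      have := closed_root_frob pcharK iota 1 (iota (z / moore p f)).
      rewrite expn1 rmorphXn /= => ->; rewrite rmorphM fmorphV mulrCA mulfV ?mulr1 //.
      by rewrite fmorph_eq0.
    * by move=> z u zZ _ zE eps _; apply: AS_sigma_elkies.
move=> r /(quot_dim_indep pcharK) dimE; split.
  rewrite dimE; split=> [indep|[fieldA _]]; last exact: field_indep fieldA.
  have fieldA : is_field (AS_alg pcharK f) by exact: AS_is_field.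
  split=> // s.
  by move/(field_Kaut_shift fieldA) => sa; apply/(AS_groupP D_neq0).
move=> /dimE indep; have fieldA : is_field (AS_alg pcharK f) by exact: AS_is_field.
split.
  exact: has_card_pcyclic.
by move=> E repE V; apply: pcyclic_reps.
Qed.
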